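(* Let $\mathcal G$ be a class of (finite, undirected) graphs. The following four statements are equivalent. (1) $\mathcal G$ has structurally bounded treewidth, i.e., there exist a graph class $\mathcal G'$ of bounded treewidth and a first-order transduction $\tau$ such that $\mathcal G \subseteq \tau(\mathcal G')$. (2) There exists a number $t$ such that every graph in $\mathcal G$ has a lacon-decomposition $(L,\pi)$ with $\mathrm{col}_\infty(L,\pi)\le t-1$. (3) There exist a number $t$ and a signature $S$ such that every graph in $\mathcal G$ has a shrub-decomposition $(F,S)$ with one color, diameter at most $t$, and such that $F$ has treewidth at most $t$. (4) There exist a number $d$ and a graph class $\mathcal G'$ of bounded treewidth such that every graph in $\mathcal G$ has a parity-decomposition $P\in\mathcal G'$ of target-degree at most $d$.
   Context: A linear order on the vertices of a graph is an injective map $\pi: V\to\mathbb N$. A vertex $u$ is $r$-reachable from $v$ (w.r.t. $\pi$) if $\pi(u)\le\pi(v)$ and there is a path of length at most $r$ from $v$ to $u$ all of whose vertices $w$ satisfy $w=u$ or $\pi(w)\ge\pi(v)$; $\mathrm{col}_r(G,\pi)$ is the maximum over $v$ of the number of vertices $r$-reachable from $v$, and $\mathrm{col}_\infty(G,\pi)$ is the same quantity with no bound on the path length. Lacon-decomposition: a pair $(L,\pi)$ where $L$ is a bipartite graph with sides $T$ (target vertices) and $H$ (hidden vertices), each hidden vertex is labeled ''0'' or ''1'', $\pi$ is a linear order on $V(L)$ with $\pi(h)<\pi(t)$ for all $h\in H,t\in T$, and for all $t,t'\in T$ we have $N(t)\cap N(t')\neq\emptyset$; the $\pi$-largest vertex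 of $N(t)\cap N(t')$ is the dominant vertex of $t,t'$. It is a lacon-decomposition of a graph $G$ if $V(G)=T$ and for all $t\ne t'\in T$, $tt'\in E(G)$ iff the dominant vertex of $t,t'$ is labeled ''1''. Shrub-decomposition of $m$ colors and diameter $d$ of a graph $G$: a pair $(F,S)$ with $F$ an undirected graph and $S\subseteq\{1,\dots,m\}^2\times\{1,\dots,d\}$ such that any two vertices of $F$ have distance at most $d$ in $F$, the set of degree-one vertices of $F$ is exactly $V(G)$, each degree-one vertex of $F$ is assigned a color in $\{1,\dots,m\}$, $(i,j,l)\in S$ iff $(j,i,l)\in S$, and for all $u,v\in V(G)$ with colors $i,j$ and $F$-distance $l$, $uv\in E(G)$ iff $(i,j,l)\in S$. Parity-decomposition of target-degree $d$ of a graph $G$: a bipartite graph $P$ with sides $T,H$ in which every vertex of $T$ has degree at most $d$, $T=V(G)$, and for all $t\ne t'\in T$, $tt'\in E(G)$ iff $|N(t)\cap N(t')|$ is odd. First-order transductions: a basic transduction is a triple $\tau_0=(\chi,\nu,\varphi)$ of first-order formulas with $0,1,2$ free variables; $\tau_0(G)$ is undefined if $G\not\models\chi$, otherwise it is the graph with vertex set $\{v: G\models\nu(v)\}$ and edges $uv$ ($u\neq v$) with $G\models\varphi(u,v)\lor\varphi(v,u)$. A $p$-parameter expansion maps $G$ to the set of all graphs obtained by adding $p$ unary predicates to $G$. An $m$-copy operation maps $G$ to the graph with vertex set $V(G)\times\{1,\dots,m\}$, edges $(v,i)(w,i)$ for $vw\in E(G)$, a binary relation $\sim$ with $(u,i)\sim(v,j)$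 iff $u=v$, and unary predicates $Q_i=V(G)\times\{i\}$. A transduction is $\tau=\tau_0\circ\gamma\circ\varepsilon$ with $\varepsilon$ a parameter expansion, $\gamma$ a copy operation, $\tau_0$ a basic transduction; $\tau(\mathcal G')=\bigcup_{G\in\mathcal G'}\tau(G)$. *)

(* Defs.v *)
From mathcomp Require Import all_boot.

Set Implicit Arguments.
Unset Strict Implicit.
Unset Printing Implicit Defensive.

Record sgraph := SGraph {
  vertex :> finType;
  adj : rel vertex;
  adj_sym : symmetric adj;
  adj_irr : irreflexive adj }.

Definition graph_class := sgraph -> Prop.

Definition isomorphic (G H : sgraph) : Prop :=
  exists2 f : G -> H, bijective f & {mono f : x y / adj x y}.

Definition nbh (G : sgraph) (x : G) : {set G} := [set y | adj x y].

Definition degree (G : sgraph) (x : G) : nat := #|nbh x|.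

(* Holds iff the distance is finite and equal to l. The sequence p lists the
   vertices after the starting point x, so the length of x :: p is [size p]. *)
Definition distance (G : sgraph) (x y : G) (l : nat) : Prop :=
  (exists p : seq G, [/\ path (@adj G) x p, last x p = y & size p = l])
  /\ (forall p : seq G, path (@adj G) x p -> last x p = y -> l <= size p).

(* A closed sequence of distinct vertices of size 2 is an edge traversed back
   and forth, hence the bound on the size of genuine cycles. *)
Definition is_tree (T : sgraph) : Prop :=
  [/\ 0 < #|T|,
      forall x y : T, connect (@adj T) x y
    & forall c : seq T, 2 < size c -> ~ ucycle (@adj T) c].

Definition tree_decomposition (G T : sgraph) (bag : T -> {set G}) : Prop :=
  [/\ is_tree T,
      forall v : G, exists s : T, v \in bag s,
      forall u v : G, adj u v -> exists s : T, (u \in bag s) && (v \in bag s)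
    & forall (v : G) (s t : T), v \in bag s -> v \in bag t ->
        connect [rel x y : T | [&& adj x y, v \in bag x & v \in bag y]] s t].

Definition treewidth_at_most (k : nat) (G : sgraph) : Prop :=
  exists (T : sgraph) (bag : T -> {set G}),
    tree_decomposition bag /\ forall s : T, #|bag s| <= k.+1.

Definition bounded_treewidth (C : graph_class) : Prop :=
  exists k : nat, forall G : sgraph, C G -> treewidth_at_most k G.

Section Bipartite.
Variables (T H : finType) (B : T -> H -> bool).

Definition bip_adj : rel (T + H)%type := fun x y =>
  match x, y with
  | inl t, inr h => B t h
  | inr h, inl t => B t h
  | _, _ => false
  end.

Lemma bip_adj_sym : symmetric bip_adj. Proof. by case=> ? []. Qed.

Lemma bip_adj_irr : irreflexive bip_adj. Proof. by case. Qed.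

Definition bip_graph : sgraph := SGraph bip_adj_sym bip_adj_irr.
End Bipartite.

(* The restricted relation only enters vertices y with y = u or pi y >= pi v;
   the starting vertex v satisfies this trivially. *)
Definition inf_reachable (G : sgraph) (pi : G -> nat) (v u : G) : bool :=
  (pi u <= pi v) &&
  connect [rel x y : G | adj x y && ((y == u) || (pi v <= pi y))] v u.

Definition col_inf (G : sgraph) (pi : G -> nat) : nat :=
  \max_(v : G) #|[set u | inf_reachable pi v u]|.

(* The target side is V(G) itself and H is the hidden side; [label h] holds iff
   h is labeled "1". *)
Section Lacon.
Variables (G : sgraph) (H : finType) (B : G -> H -> bool) (label : H -> bool).
Variable pi : bip_graph B -> nat.

Definition common_nbh (t t' : G) : {set bip_graph B} :=
  nbh (inl t : bip_graph B) :&: nbh (inl t' : bip_graph B).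

Definition dominant (t t' : G) (h : H) : Prop :=
  inr h \in common_nbh t t' /\
  forall x, x \in common_nbh t t' -> pi x <= pi (inr h).

Definition lacon_decomposition : Prop :=
  [/\ injective pi,
      forall (h : H) (t : G), pi (inr h) < pi (inl t),
      forall t t' : G, common_nbh t t' != set0
    & forall (t t' : G) (h : H), t != t' -> dominant t t' h ->
        adj t t' = label h].
End Lacon.

(* Colors are indexed by 'I_m. The identification of V(G) with the set of
   degree-one vertices of F is an injection [leaf]. *)
Definition shrub_decomposition (m d : nat) (G F : sgraph)
    (S : {pred 'I_m * 'I_m * nat}) : Prop :=
  [/\ forall i j l, (i, j, l) \in S -> 0 < l <= d,
      forall i j l, ((i, j, l) \in S) = ((j, i, l) \in S),
      forall x y : F, exists2 l, l <= d & distance x y l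
    & exists (leaf : G -> F) (color : G -> 'I_m),
      [/\ injective leaf,
          forall x : F, degree x = 1 <-> exists v : G, leaf v = x
        & forall (u v : G) (l : nat), distance (leaf u) (leaf v) l ->
            adj u v = ((color u, color v, l) \in S)]].

Definition parity_decomposition (d : nat) (G : sgraph) (H : finType)
    (B : G -> H -> bool) : Prop :=
  (forall t : G, degree (inl t : bip_graph B) <= d) /\
  (forall t t' : G, t != t' -> adj t t' = odd #|common_nbh B t t'|).

Record structure (U B : Type) := Structure {
  dom :> finType;
  unary : U -> pred dom;
  binary : B -> rel dom }.

(* Formulas whose free variables are among 'I_n; a quantifier binds variable 0
   and shifts the others. *)
Inductive fo (U B : Type) : nat -> Type :=
| FOFalse n : fo U B n
| FOEq n (x y : 'I_n) : fo U B n
| FOUn n (P : U) (x : 'I_n) : fo U B n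
| FOBin n (R : B) (x y : 'I_n) : fo U B n
| FONot n (f : fo U B n) : fo U B n
| FOAnd n (f g : fo U B n) : fo U B n
| FOOr n (f g : fo U B n) : fo U B n
| FOEx n (f : fo U B n.+1) : fo U B n
| FOAll n (f : fo U B n.+1) : fo U B n.

Fixpoint sat (U B : Type) (A : structure U B) n (f : fo U B n) :
    n.-tuple A -> bool :=
  match f in fo _ _ n return n.-tuple A -> bool with
  | FOFalse _ => fun _ => false
  | FOEq _ x y => fun e => tnth e x == tnth e y
  | FOUn _ P x => fun e => unary P (tnth e x)
  | FOBin _ R x y => fun e => binary R (tnth e x) (tnth e y)
  | FONot _ f => fun e => ~~ sat f e
  | FOAnd _ f g => fun e => sat f e && sat g e
  | FOOr _ f g => fun e => sat f e || sat g e
  | FOEx _ f => fun e => [exists a : A, sat f [tuple of a :: e]]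
  | FOAll _ f => fun e => [forall a : A, sat f [tuple of a :: e]]
  end.

(* The only binary symbol, [tt], is adjacency. *)
Definition expansion (p : nat) (G : sgraph) (P : 'I_p -> pred G) :
    structure 'I_p unit :=
  Structure P (fun _ : unit => @adj G).

(* Binary symbols: [Some R] is the copy of R, [None] is the relation ~.
   Unary symbols: [inl P] is the copy of P, [inr i] is Q_i. *)
Definition copy (m : nat) (U B : Type) (A : structure U B) :
    structure (U + 'I_m) (option B) :=
  @Structure (U + 'I_m) (option B) (A * 'I_m)%type
    (fun s x => match s with inl P => unary P x.1 | inr i => x.2 == i end)
    (fun s x y => match s with
       | Some R => (x.2 == y.2) && binary R x.1 y.1
       | None => x.1 == y.1
       end).

Record basic_transduction (U B : Type) := BasicTransduction {
  chi : fo U B 0;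
  nu : fo U B 1;
  phi : fo U B 2 }.

Section BasicTransduction.
Variables (U B : Type) (tau0 : basic_transduction U B) (A : structure U B).

Definition basic_defined : bool := sat (A := A) (chi tau0) [tuple].

Definition basic_vertex : finType := {v : A | sat (nu tau0) [tuple v]}.

Definition basic_adj : rel basic_vertex := fun u v =>
  (u != v) && (sat (phi tau0) [tuple val u; val v] ||
               sat (phi tau0) [tuple val v; val u]).

Lemma basic_adj_sym : symmetric basic_adj.
Proof. by move=> u v; rewrite /basic_adj eq_sym orbC. Qed.

Lemma basic_adj_irr : irreflexive basic_adj.
Proof. by move=> u; rewrite /basic_adj eqxx. Qed.

Definition basic_graph : sgraph := SGraph basic_adj_sym basic_adj_irr.
End BasicTransduction.

Record transduction := Transduction {
  params : nat;
  copies : nat;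
  basic : basic_transduction ('I_params + 'I_copies) (option unit) }.

(* Membership in the image of a class is up to isomorphism. *)
Definition transduce (tau : transduction) (C : graph_class) : graph_class :=
  fun G => exists (G' : sgraph) (P : 'I_(params tau) -> pred G'),
    let A := copy (copies tau) (expansion P) in
    [/\ C G', basic_defined (basic tau) A
      & isomorphic G (basic_graph (basic tau) A)].

Definition structurally_bounded_treewidth (C : graph_class) : Prop :=
  exists (C' : graph_class) (tau : transduction),
    bounded_treewidth C' /\ forall G : sgraph, C G -> transduce tau C' G.

(* Main.v *)
Require Import Defs.
From mathcomp Require Import all_boot zify.

(* A chordal order assigns to every vertex [v] a set [back v] of vertices that
   are at most [v] and pairwise linked by [back]. A small treewidth and a small
   [col_inf] both amount to a chordal order that covers the edges by small sets.

   From (1) to (2): on structures with a chordal order of bounded width, naming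
   the elements of [back v] by unary functions and adding finitely many colours
   eliminates quantifiers, so that [phi(x, y)] depends only on colours and on
   coincidences between iterated ancestors of [x] and [y]. All the common
   ancestors of [x] and [y] are ancestors of the largest one, [w]; hence
   [phi(x, y)] is determined by the types of [x] and [y] relative to [w], and
   the pairs of a vertex [w] and a set of types serve as hidden vertices.

   From (2) to (3): the edge from a target to its [i]-th smallest hidden
   neighbour is replaced by a path that gets shorter as [i] grows, so that the
   shortest detour passes through the dominant vertex, whose label is encoded
   in the length modulo 4.

   From (2) to (4): the hidden vertices are the nonempty sets [A] of old ones
   whose smallest member has label 1, adjacent to the targets whose
   neighbourhood contains [A]; the number of such [A] inside a set [X] has the
   parity of the label of the largest member of [X]. *)

Set Implicit Arguments.
Unset Strict Implicit.
Unset Printing Implicit Defensive.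

(** * Chordal orders and treewidth *)

(** Ties of [f] are broken by [enum_rank], which is below [#|X|], so that orders can be given by
    coarse keys. *)
Definition linearize (X : finType) (f : X -> nat) (x : X) : nat :=
  f x * #|X| + enum_rank x.

Lemma linearize_lt (X : finType) (f : X -> nat) x y :
  f x < f y -> linearize f x < linearize f y.
Proof.
move=> lt_f; apply: leq_trans (leq_addr _ _).
apply: (@leq_trans ((f x).+1 * #|X|)); last by rewrite leq_mul2r lt_f orbT.
by rewrite mulSnr ltn_add2l ltn_ord.
Qed.

Lemma linearize_le (X : finType) (f : X -> nat) x y :
  linearize f x <= linearize f y -> f x <= f y.
Proof. by apply: contraTT; rewrite -!ltnNge; apply: linearize_lt. Qed.

Lemma linearize_inj (X : finType) (f : X -> nat) : injective (linearize f).
Proof.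
move=> x y eq_xy; have eqf : f x = f y.
  by apply/anti_leq/andP; split; apply: linearize_le; rewrite eq_xy.
apply/enum_rank_inj/val_inj; move: eq_xy; by rewrite /linearize eqf => /addnI.
Qed.

(** A perfect elimination order: [back v] is the closed neighbourhood of [v] among the vertices up
    to [v] in a chordal graph, hence a clique. *)
Definition chordal_order (V : finType) (pi : V -> nat) (back : V -> {set V}) :=
  [/\ injective pi, forall v, v \in back v,
      forall u v, u \in back v -> pi u <= pi v
    & forall u v w, u \in back v -> w \in back v -> pi u <= pi w ->
        u \in back w].

Definition covers_edges (G : sgraph) (back : G -> {set G}) : Prop :=
  forall u v : G, adj u v -> u \in back v \/ v \in back u.

Lemma card_bigcup_le (I T : finType) (P : pred I) (F : I -> {set T}) m :
  (forall i, #|F i| <= m) -> #|\bigcup_(i | P i) F i| <= #|P| * m.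
Proof.
move=> le_m; rewrite -sum_nat_const; elim/big_rec2: _ => [|i S n _ le_n].
  by rewrite cards0.
by apply: leq_trans (leq_card_setU _ _) _; rewrite leq_add.
Qed.

(** * Iterated ancestors in a chordal order *)

Section Ancestors.
Variables (V : finType) (pi : V -> nat) (back : V -> {set V}).

Fixpoint anc (n : nat) (v : V) : {set V} :=
  if n is n'.+1 then \bigcup_(u in back v) anc n' u else [set v].

Lemma ancSP n v w :
  reflect (exists2 u, u \in back v & w \in anc n u) (w \in anc n.+1 v).
Proof.
by apply: (iffP bigcupP) => -[u vu uw]; exists u.
Qed.

Lemma anc1 v : anc 1 v = back v.
Proof.
apply/setP=> u; apply/ancSP/idP => [[w vw]|vu]; last by exists u; rewrite ?set11.
by rewrite inE => /eqP->.
Qed.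

Lemma card_anc k n v : (forall u, #|back u| <= k) -> #|anc n v| <= k ^ n.
Proof.
move=> le_k; elim: n v => [|n IHn] v; first by rewrite cards1.
apply: leq_trans (card_bigcup_le _ IHn) _.
by rewrite expnS leq_mul2r le_k orbT.
Qed.

Hypothesis ch : chordal_order pi back.

Lemma anc_subS n v : anc n v \subset anc n.+1 v.
Proof.
by apply/subsetP=> u vu; apply/ancSP; exists v => //; have [_ ->] := ch.
Qed.

Lemma anc_refl n v : v \in anc n v.
Proof.
elim: n => [|n IHn]; first by rewrite set11.
exact: subsetP (anc_subS n v) _ IHn.
Qed.

Lemma back_sub_anc n u v : 0 < n -> u \in back v -> u \in anc n v.
Proof.
by case: n => // n _ vu; apply/ancSP; exists u => //; apply: anc_refl.
Qed.

Lemma anc_le n u v : u \in anc n v -> pi u <= pi v.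
Proof.
have [_ _ le_back _] := ch.
elim: n v => [|n IHn] v; first by rewrite inE => /eqP->.
by case/ancSP=> w /le_back le_wv /IHn /leq_trans ->.
Qed.

(** Let [x] be the first step of the chain from [y] to [w]. Both [x] and [v] lie in the clique
    [back y], so either [x] is one step below [v], or [v] lies in [back x] and the induction
    continues from [x]. *)
Lemma back_anc n v w y :
  v \in back y -> w \in anc n y -> pi w <= pi v -> w \in anc n v.
Proof.
have [inj _ le_back tri] := ch.
elim: n y => [|n IHn] y yv.
  rewrite !inE => /eqP-> le_yv; apply/eqP/inj/anti_leq.
  by rewrite le_yv le_back.
case/ancSP=> x yx xw le_wv; have [le_xv|/ltnW le_vx] := leqP (pi x) (pi v).
  by apply/ancSP; exists x => //; apply: (tri x y).
by apply: subsetP (anc_subS n v) _ (IHn x _ _ _) => //; apply: (tri v y).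
Qed.

(** Move [y] along its chain to [w], with one use of [back_anc] per step. The depth [m] does not
    grow, so a fixed depth suffices throughout. *)
Lemma anc_anc m n u w y :
  u \in anc m y -> w \in anc n y -> pi u <= pi w -> u \in anc m w.
Proof.
elim: n y => [|n IHn] y yu; first by rewrite inE => /eqP->.
case/ancSP=> x yx xw le_uw; apply: (IHn x) => //.
by apply: back_anc yx yu (leq_trans le_uw (anc_le xw)).
Qed.

End Ancestors.

(** Up to the first visit of [u], the vertex [v] stays an iterated ancestor of the current vertex:
    an edge upwards lengthens the chain, an edge downwards keeps it by [back_anc]. The last edge
    either forces [u = v] or makes [u] and [v] ancestors of one vertex, where [anc_anc] applies. *)
Lemma inf_reachable_back (G : sgraph) (pi : G -> nat) back :
  chordal_order pi back -> covers_edges back ->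
  forall v u, inf_reachable pi v u -> u \in back v.
Proof.
move=> ch cov v u /andP[le_uv /connectP[p]]; have [inj refl le_back _] := ch.
have eq_vu : pi v <= pi u -> u \in back v.
  by move=> le_vu; rewrite (inj u v) //; apply/eqP; rewrite eqn_leq le_uv.
suff reach q x n : v \in anc back n x ->
    path [rel x y | adj x y && ((y == u) || (pi v <= pi y))] x q ->
    last x q = u -> u \in back v.
  by move=> vp eq_u; apply: (reach p v 0) => //; rewrite set11.
elim: q x n => [|y q IHq] x n xv /=.
  by move=> _ eq_xu; apply: eq_vu; rewrite -eq_xu (anc_le ch xv).
case/andP=> /andP[xy]; case: eqVneq => [eq_yu _ _ _ | _ /= le_vy yp lastp].
  rewrite {}eq_yu in xy; have [xu|ux] := cov _ _ xy; last first.
    by rewrite -anc1; apply: (anc_anc ch) xv le_uv; rewrite anc1.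
  exact/eq_vu/(leq_trans (anc_le ch xv) (le_back _ _ xu)).
have [xy'|yx] := cov _ _ xy.
  by apply: (IHq y n.+1) => //; apply/ancSP; exists x.
by apply: (IHq y n) => //; apply: (back_anc ch yx).
Qed.

(** For the clique condition, [w] reaches [u] through [v]: the walk from [v] to [w] can be reversed
    because all its vertices are at least [w]. *)
Lemma reach_chordal_order (G : sgraph) (pi : G -> nat) :
  injective pi -> chordal_order pi (fun v => [set u | inf_reachable pi v u]).
Proof.
move=> inj; split=> // [v|u v|u v w]; rewrite ?inE.
- by rewrite /inf_reachable leqnn connect0.
- by case/andP.
case/andP=> le_uv vu /andP[le_wv vw] le_uw; rewrite /inf_reachable le_uw /=.
set r := (r in connect r w u).
apply: (@connect_trans _ _ v); last first.
  apply: connect_sub vu => x y /= /andP[xy y_ok].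
  apply: connect1; rewrite /r /= xy /=; case/predU1P: y_ok => [->|le_vy].
    by rewrite eqxx.
  by rewrite (leq_trans le_wv le_vy) orbT.
suff back_path q x : pi w <= pi x ->
    path [rel x y | adj x y && ((y == w) || (pi v <= pi y))] x q ->
    connect r (last x q) x.
  by have /connectP[q vq ->] := vw; apply: back_path.
elim: q x => [|y q IHq] x le_wx /=; first by rewrite connect0.
case/andP=> /andP[xy y_ok] /IHq lasty.
apply: connect_trans (lasty _) (connect1 _).
  by case/predU1P: y_ok => [->|]//; apply: leq_trans.
by rewrite /r /= adj_sym xy le_wx orbT.
Qed.

Lemma reach_covers_edges (G : sgraph) (pi : G -> nat) :
  covers_edges (fun v => [set u | inf_reachable pi v u]).
Proof.
move=> u v uv; have [le_uv|/ltnW le_vu] := leqP (pi u) (pi v); [left|right].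
  by rewrite inE /inf_reachable le_uv connect1 //= adj_sym uv eqxx.
by rewrite inE /inf_reachable le_vu connect1 //= uv eqxx.
Qed.

(** * From chordal orders to tree decompositions *)

Section ParentTree.
Variables (X : finType) (root : X) (parent : X -> X) (height : X -> nat).
Hypothesis parent_lt : forall x, x != root -> height (parent x) < height x.

Definition parent_adj : rel X := fun x y =>
  (x != root) && (parent x == y) || (y != root) && (parent y == x).

Lemma parent_adj_sym : symmetric parent_adj.
Proof. by move=> x y; rewrite /parent_adj orbC. Qed.

Lemma parent_adj_irr : irreflexive parent_adj.
Proof.
move=> x; rewrite /parent_adj orbb; apply/negP=> /andP[x_r /eqP px].
by have := parent_lt x_r; rewrite px ltnn.
Qed.

Definition parent_graph : sgraph := SGraph parent_adj_sym parent_adj_irr.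

(** A vertex of maximal height on a cycle would have its parent as both neighbours on the cycle. *)
Lemma parent_tree : is_tree parent_graph.
Proof.
split; first by apply/card_gt0P; exists root.
  have to_root x : connect parent_adj x root.
    elim: {x}(height x) {-2}x (leqnn (height x)) => [|n IHn] x le_n.
      have [->|/parent_lt] := eqVneq x root; rewrite ?connect0 //.
      by move=> /leq_trans/(_ le_n).
    have [->|x_r] := eqVneq x root; first exact: connect0.
    apply: (@connect_trans _ _ (parent x)).
      by apply: connect1; rewrite /parent_adj x_r eqxx.
    by apply: IHn; have /leq_trans/(_ le_n) := parent_lt x_r.
  move=> x y; apply: connect_trans (to_root x) _.
  by rewrite (sym_connect_sym parent_adj_sym).
move=> c size_c /andP[cyc_c uniq_c].
have [x0 x0c] : exists x, x \in c.
  by case: c size_c {cyc_c uniq_c} => // x c _; exists x; apply: mem_head.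
have [x xc max_x] := arg_maxnP height x0c.
have up y : y \in c -> parent_adj x y -> y = parent x.
  move=> yc /orP[/andP[_ /eqP->] // | /andP[y_r /eqP py]].
  by have := parent_lt y_r; rewrite py ltnNge => /negP[]; apply: max_x.
have [i q rot_c] := rot_to xc.
move: size_c cyc_c uniq_c up; rewrite -(size_rot i) -(rot_cycle i) -(rot_uniq i).
have mem_c : rot i c =i c by apply: mem_rot.
rewrite rot_c in mem_c *; case: q {rot_c} mem_c => [|y q] //= mem_c size_q.
rewrite rcons_path => /and3P[xy _ zx] /and3P[_ y_q _] up.
have /up : last y q \in c by rewrite -mem_c inE mem_last orbT.
rewrite parent_adj_sym zx => /(_ isT).
have /up/(_ xy) <- : y \in c by rewrite -mem_c !inE eqxx orbT.
by case: q size_q y_q {mem_c zx} => //= z q _ y_q eq_y; rewrite -{1}eq_y mem_last in y_q.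
Qed.
End ParentTree.

(** The tree has a node [Some v] with bag [back v] for each vertex [v], and a root [None] with empty
    bag that joins the components. The parent of [v] is the largest other member of [back v]; by the
    clique condition, its bag contains all of [back v] except [v]. *)
Lemma chordal_treewidth (G : sgraph) (pi : G -> nat) back k :
  chordal_order pi back -> covers_edges back ->
  (forall v, #|back v| <= k.+1) -> treewidth_at_most k G.
Proof.
move=> [inj refl le_back tri] cov le_k.
pose prev v m := (m \in back v :\ v) && [forall x in back v :\ v, pi x <= pi m].
pose parent ov := if ov is Some v then [pick m | prev v m] else None.
pose height ov := if ov is Some v then (pi v).+1 else 0.
have parent_lt ov : ov != None -> height (parent ov) < height ov.
  case: ov => // v _ /=; case: pickP => //= m /andP[/setD1P[mv /le_back]].
  rewrite ltnS leq_eqVlt => /predU1P[/inj eq_mv|//].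
  by rewrite eq_mv eqxx in mv.
pose T := parent_graph parent_lt.
pose bag (ov : T) : {set G} := if ov is Some v then back v else set0.
exists T, bag; split; last by case=> [v|] /=; rewrite ?le_k ?cards0.
split; first exact: parent_tree.
- by move=> v; exists (Some v); apply: refl.
- move=> u v /cov[uv|vu]; first by exists (Some v); rewrite /= uv refl.
  by exists (Some u); rewrite /= vu refl.
move=> v s t; set r := (r in connect r).
have r_sym : symmetric r.
  by move=> x y; rewrite /r /= [parent_adj _ _ _ _]parent_adj_sym [_ && (v \in _)]andbC.
have to_v ox : v \in bag ox -> connect r ox (Some v).
  elim: {ox}(height ox) {-2}ox (leqnn (height ox)) => [|n IHn] [x|] //=;
    rewrite ?inE // ltnS => le_n xv.
  have [->|ne_vx] := eqVneq v x; first exact: connect0.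
  have [m pr_m] : exists m, parent (Some x) = Some m.
    rewrite /=; case: pickP => [m|none]; first by exists m.
    have v_x : v \in back x :\ x by rewrite !inE ne_vx.
    have [m x_m max_m] := arg_maxnP pi v_x.
    have /idP[] := none m; apply/andP; split; first exact: x_m.
    by apply/forall_inP => y /max_m.
  have /andP[/setD1P[mx xm] /forall_inP max_m] : prev x m.
    by move: pr_m; rewrite /=; case: pickP => // m' pr_m' [<-].
  have v_m : v \in back m by apply: (tri v x) => //; apply: max_m; rewrite !inE ne_vx.
  apply: (@connect_trans _ _ (Some m)).
    by apply: connect1; rewrite /r /= xv v_m /parent_adj pr_m /= eqxx.
  apply: IHn => //=; apply: leq_trans le_n.
  by have := parent_lt (Some x) isT; rewrite pr_m.
move=> /to_v vs /to_v vt; apply: connect_trans vs _.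
by rewrite (sym_connect_sym r_sym).
Qed.

(** * From tree decompositions to chordal orders *)

Section Distance.
Variables (G : sgraph) (r : G).
Hypothesis conn : forall x y : G, connect (@adj G) x y.

Lemma walk_to_exists x :
  exists n, [exists p : n.-tuple G, path (@adj G) r p && (last r p == x)].
Proof.
have /connectP[p rp ->] := conn r x.
by exists (size p); apply/existsP; exists (in_tuple p); rewrite rp eqxx.
Qed.

Definition dist_from x := ex_minn (walk_to_exists x).

Lemma dist_from_le p : path (@adj G) r p -> dist_from (last r p) <= size p.
Proof.
move=> rp; rewrite /dist_from; case: ex_minnP => n _; apply.
by apply/existsP; exists (in_tuple p); rewrite rp eqxx.
Qed.

Lemma dist_fromP x :
  exists p, [/\ path (@adj G) r p, last r p = x & size p = dist_from x].
Proof.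
rewrite /dist_from; case: ex_minnP => n /existsP[p /andP[rp /eqP lastp]] _.
by exists p; rewrite size_tuple.
Qed.

Lemma dist_from_eq0 x : dist_from x = 0 -> x = r.
Proof. by case: (dist_fromP x) => -[|y p] [_ <- <-]. Qed.

Lemma dist_from_adj x y : adj x y -> dist_from y <= (dist_from x).+1.
Proof.
have [p [rp <- <-]] := dist_fromP x => xy.
have := @dist_from_le (rcons p y); rewrite rcons_path rp xy last_rcons size_rcons.
exact.
Qed.

Lemma dist_from_parent x : x != r -> exists2 y, adj y x & dist_from y < dist_from x.
Proof.
have [p] := dist_fromP x; case/lastP: p => [|p y] [] /=.
  by move=> _ <-; rewrite eqxx.
rewrite rcons_path last_rcons size_rcons => /andP[rp lasty] <- <- _.
by exists (last r p) => //; rewrite ltnS dist_from_le.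
Qed.
End Distance.

Section TreeToOrder.
Variables (T : sgraph) (r : T).
Hypothesis treeT : is_tree T.

Let conn : forall x y : T, connect (@adj T) x y.
Proof. by case: treeT. Qed.

Local Notation d := (dist_from r conn).

Definition cut (s t : T) : rel T :=
  [rel x y | [&& adj x y, ~~ ((x == s) && (y == t)) & ~~ ((x == t) && (y == s))]].

Lemma cut_sym s t : symmetric (cut s t).
Proof.
move=> x y; rewrite /cut /= adj_sym [(y == s) && _]andbC [(y == t) && _]andbC.
by rewrite [~~ _ && ~~ _ in RHS]andbC.
Qed.

Lemma tree_bridge s t : adj s t -> ~~ connect (cut s t) s t.
Proof.
move=> st; apply/negP=> /connectP[p sp lastp].
have [_ _ acyc] := treeT; have{p sp lastp} [q sq [uniq_q lastq]] :
    exists2 q, path (cut s t) s q & uniq (s :: q) /\ t = last s q.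
  by case/shortenP: sp lastp => q sq uniq_q _ lastq; exists q.
have sub_cut : subrel (cut s t) (@adj T) by move=> x y /and3P[].
case: q => [|y [|z q]] in sq uniq_q lastq.
- by rewrite lastq adj_irr in st.
- by move: sq; rewrite /cut lastq /= !eqxx; case: adj.
apply: (acyc (s :: y :: z :: q)) => //; rewrite /ucycle uniq_q andbT.
have := sub_path sub_cut sq; rewrite /= rcons_path => /and3P[-> -> ->] /=.
by rewrite adj_sym; move: lastq => /= <-.
Qed.

(** In the tree rooted at [r] these are the descendants of [s]; the depth condition spares a parent
    function. *)
Definition subtree (s : T) : {set T} :=
  [set t | connect [rel x y | [&& adj x y, d s <= d x & d s <= d y]] s t].

Lemma subtree_refl s : s \in subtree s.
Proof. by rewrite inE connect0. Qed.

Lemma subtree_adj s x y : x \in subtree s -> adj x y -> d s <= d x -> d s <= d y ->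
  y \in subtree s.
Proof.
rewrite !inE => sx xy le_x le_y; apply: connect_trans sx (connect1 _).
by rewrite /= xy le_x.
Qed.

Lemma subtree_dist s t : t \in subtree s -> d s <= d t.
Proof.
rewrite inE => /connectP[p]; case/lastP: p => [_ -> //|p x].
by rewrite rcons_path last_rcons => /andP[_ /and3P[_ _ le_x]] ->.
Qed.

(** The edge leaves towards the root, so [t] is as deep as [s]. If [t] were not [s], the edge could
    be bypassed: from [t] to [s] inside the subtree, up to the root and down to [t'], against
    [tree_bridge]. *)
Lemma subtree_boundary s t t' :
  t \in subtree s -> adj t t' -> t' \notin subtree s -> t = s.
Proof.
move=> st tt' st'; apply/eqP; apply: contraT => ne_ts.
have le_st := subtree_dist st.
have lt_t's : d t' < d s.
  by rewrite ltnNge; apply: contra st'; apply: subtree_adj st _ _.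
have eq_d : d t = d s.
  apply/eqP; rewrite eqn_leq le_st andbT (leq_trans _ lt_t's) //.
  by apply: dist_from_adj; rewrite adj_sym.
have to_root n x : d x <= n -> d x <= d t -> x != t -> connect (cut t t') x r.
  elim: n x => [|n IHn] x le_n le_t ne_xt.
    by move: le_n; rewrite leqn0 => /eqP/dist_from_eq0->; apply: connect0.
  have [->|ne_xr] := eqVneq x r; first exact: connect0.
  have [y yx lt_yx] := dist_from_parent conn ne_xr.
  have ne_yt : y != t.
    by apply: contraTneq lt_yx => ->; rewrite -leqNgt.
  apply: (@connect_trans _ _ y).
    by apply: connect1; rewrite /cut /= adj_sym yx (negPf ne_xt) (negPf ne_yt) andbF.
  by apply: IHn => //; lia.
have := tree_bridge tt'; apply: contraR => _.
have csym := sym_connect_sym (cut_sym t t').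
apply: (@connect_trans _ _ s).
  rewrite csym; move: st; rewrite inE; apply: connect_sub => x y /and3P[xy lex ley].
  have ne z : d s <= d z -> z != t' by apply: contraTneq => ->; rewrite -ltnNge.
  by apply: connect1; rewrite /cut /= xy (negPf (ne _ lex)) (negPf (ne _ ley)) !andbF.
apply: (@connect_trans _ _ r).
  by apply: (to_root (d s)); rewrite ?eq_d // eq_sym.
rewrite csym; apply: (to_root (d t')) => //; first by rewrite eq_d ltnW.
by apply: contraTneq lt_t's => ->; rewrite -leqNgt.
Qed.

Lemma subtree_min s t : t \in subtree s -> d t <= d s -> t = s.
Proof.
move=> st le_ts; have [eq_tr|ne_tr] := eqVneq t r.
  have d0 : d t = 0.
    by apply/eqP; rewrite -leqn0 eq_tr; apply: (@dist_from_le _ r conn [::]).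
  by rewrite eq_tr (@dist_from_eq0 _ r conn s) //; have := subtree_dist st; lia.
have [y yt lt_yt] := dist_from_parent conn ne_tr.
apply: (subtree_boundary st (t' := y)); first by rewrite adj_sym.
by apply/negP=> /subtree_dist; lia.
Qed.

Lemma subtree_connect (B : {set T}) s x y :
  connect [rel x y | [&& adj x y, x \in B & y \in B]] x y ->
  x \in subtree s -> y \notin subtree s -> s \in B.
Proof.
move=> /connectP[p xp ->]; elim: p x xp => [|z p IHp] x /=; first by move=> _ ->.
case/andP=> /and3P[xz xB zB] zp sx.
have [sz|/(subtree_boundary sx xz)<- //] := boolP (z \in subtree s).
exact: IHp.
Qed.

Lemma subtree_sub (B : {set T}) s x y :
  connect [rel x y | [&& adj x y, x \in B & y \in B]] x y ->
  (forall z, z \in B -> d s <= d z) -> x \in subtree s -> y \in subtree s.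
Proof.
move=> /connectP[p xp ->] le_s; elim: p x xp => [|z p IHp] x //=.
case/andP=> /and3P[xz xB zB] zp sx; apply: IHp zp _.
by apply: subtree_adj sx xz _ _; apply: le_s.
Qed.

Variables (G : sgraph) (bag : T -> {set G}).
Hypothesis bag_cover : forall v, exists s, v \in bag s.
Hypothesis bag_edge : forall u v : G, adj u v ->
  exists s : T, (u \in bag s) && (v \in bag s).
Hypothesis bag_conn : forall (v : G) (s t : T), v \in bag s -> v \in bag t ->
  connect [rel x y : T | [&& adj x y, v \in bag x & v \in bag y]] s t.

Definition top v : T :=
  odflt r [pick s | (v \in bag s) && [forall t, (v \in bag t) ==> (d s <= d t)]].

Lemma topP v : v \in bag (top v) /\ forall t, v \in bag t -> d (top v) <= d t.
Proof.
rewrite /top; case: pickP => [s /andP[vs /forallP min_s]|none] /=.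
  by split=> // t vt; have /implyP := min_s t; apply.
have [s0 vs0] := bag_cover v.
have [s vs min_s] := @arg_minnP _ s0 (fun s => v \in bag s) d vs0.
have /idP[] := none s; apply/andP; split; first exact: vs.
by apply/forall_inP=> t /min_s.
Qed.

Let conn_bag v s t : v \in bag s -> v \in bag t ->
  connect [rel x y | [&& adj x y, x \in [set s | v \in bag s]
                      & y \in [set s | v \in bag s]]] s t.
Proof.
move=> vs vt; apply: connect_sub (bag_conn vs vt) => x y /= xy.
by apply: connect1; rewrite /= !inE.
Qed.

(** The node [s] lies below [top w]. If [top u] does not, the connected set of bags of [u] passes
    through [top w]; otherwise the depths force [top u = top w]. *)
Lemma mem_bag_top u w s :
  u \in bag s -> w \in bag s -> d (top u) <= d (top w) -> u \in bag (top w).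
Proof.
move=> us ws le_uw; have [u_top min_u] := topP u; have [w_top min_w] := topP w.
have s_w : s \in subtree (top w).
  apply: (subtree_sub (conn_bag w_top ws)); last exact: subtree_refl.
  by move=> z; rewrite inE; apply: min_w.
have [/subtree_min/(_ le_uw)<- //|nu] := boolP (top u \in subtree (top w)).
by have := subtree_connect (conn_bag us u_top) s_w nu; rewrite inE.
Qed.

Lemma tree_decomposition_order k : (forall s, #|bag s| <= k) ->
  exists (pi : G -> nat) back,
    [/\ chordal_order pi back, covers_edges back & forall v, #|back v| <= k].
Proof.
move=> le_k; pose pi := linearize (fun v => d (top v)).
exists pi, (fun v => [set u in bag (top v) | pi u <= pi v]); split.
- split=> [|v|u v|u v w]; rewrite ?inE; first exact: linearize_inj.
  + by rewrite leqnn andbT; case: (topP v).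
  + by case/andP.
  move=> /andP[uv _] /andP[wv _] le_uw; rewrite le_uw andbT.
  exact: mem_bag_top uv wv (linearize_le le_uw).
- move=> u v /bag_edge[s /andP[us vs]]; rewrite !inE.
  have [le_uv|/ltnW le_vu] := leqP (pi u) (pi v); [left|right].
    by rewrite (mem_bag_top us vs) ?le_uv //; exact: linearize_le le_uv.
  by rewrite (mem_bag_top vs us) ?le_vu //; exact: linearize_le le_vu.
move=> v; apply: leq_trans (le_k (top v)).
by apply/subset_leq_card/subsetP=> u; rewrite inE => /andP[].
Qed.
End TreeToOrder.

Lemma treewidth_chordal k (G : sgraph) : treewidth_at_most k G ->
  exists (pi : G -> nat) back,
    [/\ chordal_order pi back, covers_edges back & forall v, #|back v| <= k.+1].
Proof.
move=> [T [bag [[treeT cover edge bconn] le_k]]].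
have [/card_gt0P[r _] _ _] := treeT.
exact: (tree_decomposition_order r treeT cover edge bconn).
Qed.

(** * From lacon-decompositions to parity-decompositions *)

Definition hidden_nbh (T H : finType) (B : T -> H -> bool) (t : T) : {set H} :=
  [set h | B t h].

Lemma nbh_inl (T H : finType) (B : T -> H -> bool) (t : T) :
  nbh (inl t : bip_graph B) = inr @: hidden_nbh B t.
Proof.
apply/setP=> -[t'|h]; rewrite inE /=.
  by apply/esym/negbTE/imsetP=> -[].
by rewrite mem_imset ?inE // => ? ? [].
Qed.

Lemma common_nbhE (G : sgraph) (H : finType) (B : G -> H -> bool) (t t' : G) :
  common_nbh B t t' = inr @: (hidden_nbh B t :&: hidden_nbh B t').
Proof.
by rewrite /common_nbh !nbh_inl imsetI // => ? ? _ _ [].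
Qed.

Section HiddenOrder.
Variables (G : sgraph) (H : finType) (B : G -> H -> bool) (label : H -> bool).
Variables (pi : H -> nat) (back : H -> {set H}) (c : nat).
Local Notation N := (hidden_nbh B).

(** What both constructions below use of a lacon-decomposition: a chordal order of the hidden side
    alone, in which every neighbourhood of a target is a clique. *)
Definition hidden_order : Prop :=
  [/\ chordal_order pi back,
      (forall h, #|back h| <= c) /\ (forall t, #|N t| <= c),
      forall t h h', h \in N t -> h' \in N t -> pi h <= pi h' -> h \in back h',
      forall t t', N t :&: N t' != set0
    & forall t t' h, t != t' -> h \in N t :&: N t' ->
        (forall x, x \in N t :&: N t' -> pi x <= pi h) -> adj t t' = label h].
End HiddenOrder.

Lemma lacon_hidden_order (G : sgraph) (H : finType) (B : G -> H -> bool)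
    (label : H -> bool) (pi : bip_graph B -> nat) c :
  lacon_decomposition label pi -> col_inf pi <= c ->
  exists back, hidden_order B label (fun h => pi (inr h)) back c.
Proof.
move=> [inj lt_ht common dom] le_c.
pose back v := [set u | inf_reachable pi v u].
have [_ refl le_back tri] := reach_chordal_order inj.
have card_back v : #|back v| <= c by apply: leq_trans le_c; apply: (leq_bigmax v).
have inj_inr : injective (inr : H -> bip_graph B) by move=> ? ? [].
have nbh_back t h : h \in hidden_nbh B t -> inr h \in back (inl t).
  rewrite inE => th; have adj_th : adj (inr h : bip_graph B) (inl t) by [].
  have [|/le_back] := reach_covers_edges pi adj_th; first by [].
  by rewrite leqNgt lt_ht.
exists (fun h => [set h' | inr h' \in back (inr h)]); split.
- split=> [h h' /inj[] //|h|h h'|h h' h'']; rewrite !inE -?[inf_reachable _ _ _]inE.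
  + by have := refl (inr h); rewrite inE.
  + by have := le_back (inr h) (inr h'); rewrite inE; apply.
  by have := tri (inr h) (inr h') (inr h''); rewrite !inE; apply.
- split=> [h|t].
    apply: leq_trans (card_back (inr h)); rewrite -(card_imset _ inj_inr).
    by apply/subset_leq_card/subsetP=> _ /imsetP[h' hh' ->]; rewrite inE in hh'.
  apply: leq_trans (card_back (inl t)); rewrite -(card_imset _ inj_inr).
  by apply/subset_leq_card/subsetP=> _ /imsetP[h' hh' ->]; apply: nbh_back.
- move=> t h h' /nbh_back th /nbh_back th' le_hh'.
  by rewrite inE; apply: tri th th' le_hh'.
- move=> t t'; have := common t t'; rewrite common_nbhE; apply: contra => /eqP->.
  by rewrite imset0.
move=> t t' h ne_tt' hN max_h; apply: dom => //; split.
  by rewrite common_nbhE mem_imset.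
by rewrite common_nbhE => _ /imsetP[x /max_h le_x ->].
Qed.

Section Parity.
Variables (G : sgraph) (H : finType) (B : G -> H -> bool) (label : H -> bool).
Variables (pi : H -> nat) (back : H -> {set H}) (c : nat).
Hypothesis ho : hidden_order B label pi back c.
Local Notation N := (hidden_nbh B).

Definition min_label (A : {set H}) : bool :=
  [exists h in A, label h && [forall x in A, pi h <= pi x]].

(** Adding [m] pairs the nonempty subsets of [X] without [m] with those that contain [m] properly,
    and preserves [min_label], since [m] is not the minimum of a set with another member. Only the
    singleton of [m] is left over, and it counts iff [label m]. *)
Lemma odd_min_label (X : {set H}) m : m \in X ->
  (forall x, x \in X -> pi x <= pi m) ->
  odd #|[set A in powerset X | min_label A]| = label m.
Proof.
move=> mX max_m; set S := [set A in _ | _].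
pose S0 := [set A in S | m \notin A]; pose S1 := [set A in S | m \in A].
have [[inj _ _ _] _ _ _ _] := ho.
have -> : #|S| = #|S0| + #|S1|.
  rewrite -(cardsID [set A : {set H} | m \in A] S) addnC; congr (_ + _);
  by apply: eq_card => A; rewrite !inE 1?andbC.
have sub_m (A : {set H}) : A \subset X -> m |: A \subset X.
  by move=> AX; rewrite subUset sub1set mX.
have label_add (A : {set H}) : A \subset X -> A != set0 -> m \notin A ->
    min_label (m |: A) = min_label A.
  move=> AX /set0Pn[a aA] mA.
  apply/exists_inP/exists_inP => -[h hA /andP[lh /forall_inP min_h]].
    case/setU1P: hA => [eq_hm|hA].
      have : pi h <= pi a by apply: min_h; rewrite inE aA orbT.
      move=> le_ha; have eq_am : a = m.
        apply/inj/eqP; rewrite eqn_leq -{2}eq_hm le_ha andbT.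
        by apply/max_m/(subsetP AX).
      by rewrite -eq_am aA in mA.
    exists h; rewrite // lh; apply/forall_inP => x xA; apply: min_h.
    by rewrite inE xA orbT.
  exists h; rewrite ?inE ?hA ?orbT // lh; apply/forall_inP => x.
  case/setU1P => [->|/min_h //]; exact/max_m/(subsetP AX).
have -> : #|S1| = label m + #|S0|.
  rewrite (cardsD1 [set m] S1); congr (_ + _).
    rewrite !inE sub1set mX eqxx andbT /=; congr nat_of_bool.
    apply/exists_inP/idP => [[h /set1P-> /andP[]] //|lm].
    by exists m; rewrite ?inE // lm; apply/forall_inP=> x /set1P->.
  rewrite -(@card_in_imset _ _ (fun A : {set H} => m |: A) S0) => [|A A']; last first.
    rewrite !inE => /andP[_ mA] /andP[_ mA'] /(congr1 (fun A : {set H} => A :\ m)).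
    by rewrite !setU1K.
  apply: eq_card => A; apply/setD1P/imsetP.
    case=> ne_Am; rewrite !inE => /andP[/andP[AX lA] mA].
    exists (A :\ m); rewrite ?setD1K // !inE eqxx andbT.
    have AX' : A :\ m \subset X by apply: subset_trans AX; apply: subD1set.
    rewrite AX' -label_add ?setD1K ?setD11 //.
    apply: contra ne_Am; rewrite setD_eq0 subset1 => /orP[//|/eqP A0].
    by rewrite A0 inE in mA.
  case=> A'; rewrite !inE => /andP[/andP[AX' lA'] mA'] ->.
  have A'0 : A' != set0.
    by apply: contraTneq lA' => ->; apply/exists_inP=> -[h]; rewrite inE.
  rewrite sub_m // label_add // lA' !inE eqxx; split=> //.
  have /set0Pn[a aA'] := A'0; apply/eqP=> /setP/(_ a).
  by rewrite !inE aA' orbT => /esym/eqP eq_am; rewrite -eq_am aA' in mA'.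
by rewrite addnCA addnn oddD odd_double addbF; case: label.
Qed.

Definition parity_rel (t : G) (A : {set H}) : bool :=
  [&& A \subset N t & min_label A].

Lemma parity_relP (t : G) A : parity_rel t A -> A \subset N t /\ A != set0.
Proof.
case/andP=> AN /exists_inP[h hA _]; split=> //.
by apply/set0Pn; exists h.
Qed.

Lemma parity_degree t : degree (inl t : bip_graph parity_rel) <= 2 ^ c.
Proof.
rewrite /degree nbh_inl (card_imset _ (@inr_inj _ _)).
have [_ [_ card_N] _ _ _] := ho.
apply: (@leq_trans #|powerset (N t)|); last by rewrite card_powerset leq_pexp2l.
apply/subset_leq_card/subsetP=> A; rewrite !inE.
by case/parity_relP.
Qed.

Lemma parity_parity : parity_decomposition (2 ^ c) parity_rel.
Proof.
split=> [t|t t' ne_tt']; first exact: parity_degree.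
have [_ _ _ /(_ t t')/set0Pn[h0 h0N] dom] := ho.
have [m mN max_m] := @arg_maxnP _ h0 (fun h => h \in N t :&: N t') pi h0N.
rewrite (dom _ _ _ ne_tt' mN max_m) -(odd_min_label mN max_m) common_nbhE.
rewrite (card_imset _ (@inr_inj _ _)); congr (odd _); apply: eq_card => A.
by rewrite !inE /parity_rel subsetI andbACA andbb.
Qed.

Let key (x : bip_graph parity_rel) : nat :=
  match x with
  | inl _ => (\max_(h : H) pi h).+1
  | inr A => \max_(h in A) pi h
  end.

Let is_max (A : {set H}) h := (h \in A) && [forall x in A, pi x <= pi h].

(** Sets are ordered by their largest member [h], and the sets linked to [A] are subsets of the
    clique [back h]. The vertex [x] is added separately because [A] may be empty or stick out of
    [back h]. *)
Let parity_back (x : bip_graph parity_rel) : {set bip_graph parity_rel} :=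
  match x with
  | inl t => x |: inr @: hidden_nbh parity_rel t
  | inr A => x |: inr @: [set A' : {set H} |
      [&& A' != set0, linearize key (inr A') <= linearize key x &
          [exists h, is_max A h && (A' \subset back h)]]]
  end.

Lemma parity_treewidth : treewidth_at_most (2 ^ c) (bip_graph parity_rel).
Proof.
have [[inj refl le_back tri] [card_back card_N] nested _ _] := ho.
have inr_inj : injective (inr : {set H} -> bip_graph parity_rel) by move=> ? ? [].
have ex_max (A : {set H}) : A != set0 ->
    exists2 h, is_max A h & \max_(x in A) pi x = pi h.
  case/set0Pn=> a aA; have [m mA max_m] := @arg_maxnP _ a (fun h => h \in A) pi aA.
  exists m; first by rewrite /is_max mA; apply/forall_inP.
  apply/eqP; rewrite eqn_leq leq_bigmax_cond // andbT.
  by apply/bigmax_leqP.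
(* Two sets inside a common clique [D] are linked, since all members of the smaller one are at most
   the maximum of the larger one. *)
have nested_sets (A A' D : {set H}) :
    A != set0 -> A' != set0 -> A \subset D -> A' \subset D ->
    (forall h h', h \in D -> h' \in D -> pi h <= pi h' -> h \in back h') ->
    linearize key (inr A) <= linearize key (inr A') -> inr A \in parity_back (inr A').
  move=> A0 A'0 AD A'D nD le_AA'; apply/setU1P; right.
  rewrite mem_imset // inE A0 le_AA' /=.
  have [h mh eq_h] := ex_max _ A'0; apply/existsP; exists h; rewrite mh /=.
  apply/subsetP=> a aA; apply: nD; first exact: (subsetP AD).
    by apply: (subsetP A'D); case/andP: mh.
  rewrite -eq_h; have /= := linearize_le le_AA'; apply: leq_trans.
  exact: leq_bigmax_cond.
apply: (@chordal_treewidth _ (linearize key) parity_back).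
- split=> [|x|x y|x y z]; first exact: linearize_inj.
  + by case: x => x; rewrite setU11.
  + case: y => y /setU1P[-> //|/imsetP[A]]; rewrite inE.
      move=> _ ->; apply/ltnW/linearize_lt; rewrite /= ltnS.
      by apply/bigmax_leqP=> h _; apply: leq_bigmax.
    by case/and3P=> _ le_A _ ->.
  case: y => [t|A] /setU1P[->|/imsetP[A1 A1P ->]] /setU1P[->|/imsetP[A2 A2P ->]] le_xz;
    rewrite ?setU11 //.
  + have := linearize_le le_xz; rewrite /= ltnNge => /negP[].
    by apply/bigmax_leqP=> h _; apply: leq_bigmax.
  + by apply/setU1P; right; rewrite mem_imset.
  + rewrite !inE in A1P A2P.
    have [[A1N A10] [A2N A20]] := (parity_relP A1P, parity_relP A2P).
    by apply: (nested_sets _ _ (N t)) => //; apply: nested.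
  + rewrite inE in A2P; case/and3P: A2P => _ le_A2 _.
    have -> : A = A2.
      by apply/inr_inj/(linearize_inj (f := key))/anti_leq; rewrite le_A2 le_xz.
    by rewrite setU11.
  + by apply/setU1P; right; rewrite mem_imset.
  rewrite !inE in A1P A2P.
  case/and3P: A1P => A10 _ /existsP[h1 /andP[/andP[h1A /forall_inP max_h1] A1h]].
  case/and3P: A2P => A20 _ /existsP[h2 /andP[/andP[h2A /forall_inP max_h2] A2h]].
  have eq_h : h1 = h2 by apply/inj/anti_leq; rewrite max_h1 ?max_h2.
  rewrite -eq_h in A2h; apply: (nested_sets _ _ (back h1)) => // h h'.
  exact: tri.
- move=> [t|A] [t'|A'] //= tA; [right|left];
    by apply/setU1P; right; rewrite mem_imset ?inE.
case=> [t|A] /=; apply: leq_trans (leq_card_setU _ _) _;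
  rewrite cards1 (card_imset _ inr_inj) add1n ltnS.
  by have := parity_degree t; rewrite /degree nbh_inl (card_imset _ inr_inj).
have [->|/ex_max[h /andP[hA /forall_inP max_h] _]] := eqVneq A set0.
  rewrite eq_card0 // => A'; rewrite inE; apply/negP=> /and3P[_ _ /existsP[h]].
  by rewrite /is_max inE.
apply: (@leq_trans #|powerset (back h)|); last by rewrite card_powerset leq_pexp2l.
apply/subset_leq_card/subsetP=> A'; rewrite !inE.
case/and3P=> _ _ /existsP[h' /andP[/andP[h'A /forall_inP max_h'] A'h]].
by rewrite (_ : h = h') //; apply/inj/anti_leq; rewrite max_h ?max_h'.
Qed.
End Parity.

(** * From lacon-decompositions to shrub-decompositions *)

Lemma distance_fun (G : sgraph) (x y : G) l l' :
  distance x y l -> distance x y l' -> l = l'.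
Proof.
move=> [[p [xp lp <-]] min_l] [[q [xq lq <-]] min_l'].
by apply/anti_leq; rewrite min_l // min_l'.
Qed.

Lemma lipschitz_path (T : Type) (e : rel T) (f : T -> nat) x p :
  (forall y z, e y z -> f y <= (f z).+1) -> path e x p ->
  f x <= f (last x p) + size p.
Proof.
move=> lip; elim: p x => [|y p IHp] x /=; first by rewrite addn0.
by case/andP=> /lip le_xy /IHp le_y; rewrite addnS; apply: leq_trans le_xy _.
Qed.

Section Walks.
Variable G : sgraph.

Definition walk (x y : G) l : Prop :=
  exists p : seq G, [/\ path (@adj G) x p, last x p = y & size p = l].

Lemma walk0 x : walk x x 0.
Proof. by exists [::]. Qed.

Lemma walk1 x y : adj x y -> walk x y 1.
Proof. by move=> xy; exists [:: y]; rewrite /= xy. Qed.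

Lemma walk_trans x y z m n : walk x y m -> walk y z n -> walk x z (m + n).
Proof.
move=> [p [xp <- <-]] [q [yq <- <-]].
by exists (p ++ q); rewrite cat_path xp yq last_cat size_cat.
Qed.

Lemma walk_sym x y n : walk x y n -> walk y x n.
Proof.
case=> p [xp <- <-] {y n}; elim: p x xp => [|z p IHp] x /=.
  by move=> _; apply: walk0.
case/andP=> xz zp; rewrite -addn1.
by apply: walk_trans (IHp z zp) (walk1 _); rewrite adj_sym.
Qed.

Lemma walk_distance x y n : walk x y n -> exists2 l, l <= n & distance x y l.
Proof.
move=> xy; pose has_walk m :=
  [exists p : m.-tuple G, path (@adj G) x p && (last x p == y)].
have walkP m : walk x y m -> has_walk m.
  case=> p [xp lastp <-]; apply/existsP; exists (in_tuple p).
  by rewrite xp lastp eqxx.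
have ex_walk : exists m, has_walk m by exists n; apply: walkP.
case: (ex_minnP ex_walk) => m /existsP[p /andP[xp /eqP lastp]] min_m.
exists m; first exact/min_m/walkP.
split=> [|q xq lastq]; first by exists p; rewrite size_tuple.
by apply/min_m/walkP; exists q.
Qed.
End Walks.

Section Shrub.
Variables (G : sgraph) (H : finType) (B : G -> H -> bool) (label : H -> bool).
Variables (pi : H -> nat) (back : H -> {set H}) (c : nat).
Hypothesis ho : hidden_order B label pi back c.
Local Notation N := (hidden_nbh B).

Definition rank_in (t : G) (h : H) : nat := #|[set x in N t | pi x < pi h]|.

(** The base [4 * c] ensures that a walk between targets along four edge paths is never shorter than
    a detour through a single hidden vertex. *)
Definition weight (t : G) (h : H) : nat :=
  4 * c + 4 * (c - rank_in t h) + label h.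

Lemma weight_bounds t h : 4 * c <= weight t h <= 8 * c + 1.
Proof. by rewrite /weight; case: (label h) => /=; lia. Qed.

Lemma rank_in_le t h : rank_in t h <= c.
Proof.
have [_ [_ card_N] _ _ _] := ho; apply: leq_trans (card_N t).
by apply/subset_leq_card/subsetP=> x; rewrite inE => /andP[].
Qed.

Lemma rank_in_lt t h h' : h \in N t -> pi h < pi h' -> rank_in t h < rank_in t h'.
Proof.
move=> th lt_h; apply: proper_card; apply/properP; split.
  by apply/subsetP=> x; rewrite !inE => /andP[-> /ltn_trans->].
by exists h; rewrite !inE ?ltnn ?andbF // lt_h andbT; rewrite inE in th.
Qed.

(* Every rank drop costs 4 on each side, more than the labels can compensate,
   so the dominant common neighbour minimizes the length of the detour. *)
Lemma weight_dominant t t' h m : h \in N t :&: N t' -> m \in N t :&: N t' ->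
  pi h <= pi m -> weight t m + weight t' m <= weight t h + weight t' h.
Proof.
case/setIP=> th t'h /setIP[tm t'm]; have [[inj _ _ _] _ _ _ _] := ho.
rewrite leq_eqVlt => /predU1P[/inj-> //|lt_hm].
have := rank_in_lt th lt_hm; have := rank_in_lt t'h lt_hm.
have := rank_in_le t m; have := rank_in_le t' m.
by rewrite /weight; case: (label m); case: (label h) => /=; lia.
Qed.

Definition dom_of (t t' : G) : option H :=
  [pick h | (h \in N t :&: N t') && [forall x in N t :&: N t', pi x <= pi h]].

Lemma dom_ofP t t' : exists h, [/\ dom_of t t' = Some h, h \in N t :&: N t' &
  forall x, x \in N t :&: N t' -> pi x <= pi h].
Proof.
rewrite /dom_of; case: pickP => [h /andP[hN /forall_inP max_h]|none].
  by exists h.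
have [_ _ _ /(_ t t')/set0Pn[h0 h0N] _] := ho.
have [m mN max_m] := @arg_maxnP _ h0 (fun h => h \in N t :&: N t') pi h0N.
have /idP[] := none m; apply/andP; split; first exact: mN.
by apply/forall_inP=> x /max_m.
Qed.

Local Notation M := (8 * c + 3).

(** Each edge path has [8 * c + 3] inner vertices: weights are at most [8 * c + 1], so at least the
    last two inner vertices are joined to the hidden vertex. *)
Definition raw_node : finType :=
  ((G + G) + (H + G * H * 'I_(8 * c + 3)%N))%type.

(* The four kinds of nodes: leaves, targets, hidden vertices, and the inner
   vertices of the path that replaces an edge [th]. *)
Definition raw_leaf t : raw_node := inl (inl t).
Definition raw_target t : raw_node := inl (inr t).
Definition raw_hidden h : raw_node := inr (inl h).
Definition raw_path t h i : raw_node := inr (inr (t, h, i)).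

(** Hidden vertices without neighbours are discarded, since they would be isolated while all
    distances must be finite. *)
Definition valid_node (x : raw_node) : bool :=
  match x with
  | inl _ => true
  | inr (inl h) => [exists t, B t h]
  | inr (inr (t, h, _)) => B t h
  end.

(* The hidden vertex [h] is joined to all path vertices from index [weight t h]
   on, so that no inner vertex has degree one. *)
Definition arc (x y : raw_node) : bool :=
  match x, y with
  | inl (inl t), inl (inr t') => t == t'
  | inl (inr t), inr (inr (t', _, i)) => (t == t') && (i == 0 :> nat)
  | inr (inr (t, h, i)), inr (inr (t', h', j)) =>
      [&& t == t', h == h' & j == i.+1 :> nat]
  | inr (inr (t, h, i)), inr (inl h') => (h == h') && (weight t h <= i)
  | _, _ => false
  end.

Definition shrub_adj : rel {x : raw_node | valid_node x} :=
  fun x y => arc (val x) (val y) || arc (val y) (val x).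

Lemma shrub_adj_sym : symmetric shrub_adj.
Proof. by move=> x y; rewrite /shrub_adj orbC. Qed.

Lemma shrub_adj_irr : irreflexive shrub_adj.
Proof.
move=> [[[t|t]|[h|[[t h] i]]] /= vx]; rewrite /shrub_adj //= !eqxx /=.
by rewrite orbb; apply/negP; lia.
Qed.

Definition shrub_graph : sgraph := SGraph shrub_adj_sym shrub_adj_irr.

Definition leaf_node t : shrub_graph := exist valid_node (raw_leaf t) isT.
Definition target_node t : shrub_graph := exist valid_node (raw_target t) isT.
Definition path_node t h (th : B t h) i : shrub_graph :=
  exist valid_node (raw_path t h i) th.

Lemma valid_hidden t h : B t h -> valid_node (raw_hidden h).
Proof. by move=> th; apply/existsP; exists t. Qed.

Definition hidden_node h (vh : valid_node (raw_hidden h)) : shrub_graph :=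
  exist valid_node (raw_hidden h) vh.

Lemma M_gt0 : 0 < M. Proof. by rewrite addnS. Qed.

Lemma walk_leaf_path t h (th : B t h) i : walk (leaf_node t) (path_node th i) i.+2.
Proof.
case: i => i lt_i; elim: i lt_i => [|i IHi] lt_i.
  apply: (walk_trans (m := 1) (n := 1) (y := target_node t)); apply: walk1.
    by rewrite /= /shrub_adj /= eqxx.
  by rewrite /= /shrub_adj /= eqxx.
rewrite -[i.+3]addn1; apply: walk_trans (IHi (ltnW lt_i)) (walk1 _).
by rewrite /= /shrub_adj /= !eqxx.
Qed.

Lemma walk_leaf_hidden t h (th : B t h) (vh : valid_node (raw_hidden h)) :
  walk (leaf_node t) (hidden_node vh) (weight t h + 3).
Proof.
have lt_w : weight t h < M by have := weight_bounds t h; lia.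
rewrite -(addn1 2) addnA; apply: (@walk_trans _ _ (path_node th (Ordinal lt_w))).
  by rewrite addn2; apply: walk_leaf_path.
by apply: walk1; rewrite /= /shrub_adj /= eqxx leqnn.
Qed.

Lemma walk_leaf_leaf t t' h : h \in N t :&: N t' ->
  walk (leaf_node t) (leaf_node t') (weight t h + weight t' h + 6).
Proof.
case/setIP; rewrite !inE => th t'h.
have -> : weight t h + weight t' h + 6 = (weight t h + 3) + (weight t' h + 3) by lia.
apply: walk_trans (walk_leaf_hidden th (valid_hidden th)) _.
exact/walk_sym/walk_leaf_hidden.
Qed.

Lemma walk_some_leaf (x : shrub_graph) :
  exists t l, l <= 8 * c + 5 /\ walk (leaf_node t) x l.
Proof.
case: x => [[[t|t]|[h|[[t h] i]]] /= vx].
- by exists t, 0; rewrite leq0n (bool_irrelevance vx isT); split=> //; apply: walk0.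
- exists t, 1; rewrite (bool_irrelevance vx isT) addnS; split=> //.
  by apply: walk1; rewrite /= /shrub_adj /= eqxx.
- have [t th] := existsP vx; exists t, (weight t h + 3).
  split; last exact: walk_leaf_hidden th vx.
  by have := weight_bounds t h; lia.
exists t, i.+2; split; last exact: (walk_leaf_path vx).
by have := ltn_ord i; lia.
Qed.

(** Each node is within [8 * c + 5] of a leaf, and two leaves are within [16 * c + 8] of each
    other. *)
Definition shrub_diameter := 32 * c + 18.

Lemma shrub_diameterP (x y : shrub_graph) :
  exists2 l, l <= shrub_diameter & distance x y l.
Proof.
have [t [m [le_m tx]]] := walk_some_leaf x.
have [t' [n [le_n t'y]]] := walk_some_leaf y.
have [h [_ hN _]] := dom_ofP t t'.
have [l le_l dist_l] := walk_distance
  (walk_trans (walk_sym tx) (walk_trans (walk_leaf_leaf hN) t'y)).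
exists l => //; apply: leq_trans le_l _.
have := weight_bounds t h; have := weight_bounds t' h.
by rewrite /shrub_diameter; lia.
Qed.

(** * A lower bound on the distance to a fixed leaf *)

Section Potential.
Variable t' : G.

(** From an [h] not adjacent to [t'], a walk to [t'] needs at least three edge paths of length at
    least [4 * c + 2], whence [12 * c + 6]. *)
Definition hidden_pot h : nat := if B t' h then weight t' h + 3 else 12 * c + 6.

Definition target_pot t : nat :=
  if t == t' then 1 else
  if dom_of t t' is Some h then weight t h + weight t' h + 5 else 0.

(** It changes by at most one along edges and vanishes at the leaf of [t']; its value at another
    leaf is the length of the dominant detour, which therefore bounds every walk from below. On an
    edge path it is the smaller of the extensions from both ends; the truncated subtraction reflects
    the direct edges to [h] from index [weight t h] on. *)
Definition potential (x : raw_node) : nat :=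
  match x with
  | inl (inl t) => if t == t' then 0 else (target_pot t).+1
  | inl (inr t) => target_pot t
  | inr (inl h) => hidden_pot h
  | inr (inr (t, h, i)) =>
      minn (target_pot t + i.+1) (hidden_pot h + (weight t h - i).+1)
  end.

(** The ends are [weight t h + 2] apart along their path, so this makes the extensions from both
    ends compatible. For a common neighbour [h] the dominant vertex gives the shortest detour;
    otherwise the base [4 * c] of the weights decides. *)
Lemma pot_edge t h : B t h ->
  (target_pot t <= hidden_pot h + weight t h + 2) &&
  (hidden_pot h <= target_pot t + weight t h + 2).
Proof.
move=> th; rewrite /target_pot /hidden_pot.
have [eq_tt'|ne_tt'] := eqVneq t t'.
  by move: th; rewrite eq_tt' => ->; lia.
have [m [-> mN max_m]] := dom_ofP t t'.
have := (weight_bounds t m, weight_bounds t' m, weight_bounds t h, weight_bounds t' h).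
case: ifP => [t'h|_]; last by case=> [[[? ?] ?] ?]; lia.
have hN : h \in N t :&: N t' by rewrite !inE th.
have := weight_dominant hN mN (max_m _ hN).
by move=> ? [[[? ?] ?] ?]; lia.
Qed.

Lemma potential_arc x y : valid_node x -> valid_node y -> arc x y ->
  (potential x <= (potential y).+1) && (potential y <= (potential x).+1).
Proof.
case: x y => [[t|t]|[h|[[t h] i]]] [[s|s]|[k|[[s k] j]]] //= vx vy.
- move/eqP<-; case: eqVneq => [->|_]; last by rewrite leqnn ltnW.
  by rewrite /target_pot eqxx.
- by case/andP=> /eqP eq_ts /eqP->; subst s; have := pot_edge vy; lia.
- case/andP=> /eqP eq_hk le_w; subst k; have := pot_edge vx; lia.
by case/and3P=> /eqP eq_ts /eqP eq_hk /eqP->; subst s k; have := pot_edge vx; lia.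
Qed.

Lemma potential_adj (x y : shrub_graph) :
  adj x y -> potential (val x) <= (potential (val y)).+1.
Proof.
case/orP=> xy; [have := potential_arc (valP x) (valP y) xy|
                have := potential_arc (valP y) (valP x) xy]; by case/andP.
Qed.
End Potential.

Lemma distance_leaf t t' h : t != t' -> h \in N t :&: N t' ->
  (forall x, x \in N t :&: N t' -> pi x <= pi h) ->
  distance (leaf_node t) (leaf_node t') (weight t h + weight t' h + 6).
Proof.
move=> ne_tt' hN max_h; split; first exact: walk_leaf_leaf.
move=> p tp lastp.
have /= := lipschitz_path (@potential_adj t') tp.
rewrite lastp /= eqxx (negPf ne_tt') /target_pot (negPf ne_tt').
have [m [-> mN max_m]] := dom_ofP t t'; have [[inj _ _ _] _ _ _ _] := ho.
by have -> : m = h by [apply/inj/anti_leq; rewrite max_h // max_m]; lia.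
Qed.

Lemma degree_gt1 (x y z : shrub_graph) : adj x y -> adj x z -> y != z ->
  degree x <> 1.
Proof.
move=> xy xz ne_yz deg1; suff: 1 < degree x by rewrite deg1.
rewrite /degree -[2](_ : #|[set y; z]| = 2); last by rewrite cards2 ne_yz.
by apply/subset_leq_card/subsetP=> u /set2P[] ->; rewrite inE.
Qed.

(** Every other node has two neighbours: a target has its leaf and the start of a path, which exists
    because [N t] meets itself; a hidden vertex has the last two vertices of a path; an inner vertex
    has its predecessor and its successor or the hidden vertex. *)
Lemma leaf_degree (x : shrub_graph) : degree x = 1 <-> exists t, leaf_node t = x.
Proof.
split=> [deg1|[t <-]]; last first.
  rewrite /degree (_ : nbh _ = [set target_node t]) ?cards1 //.
  apply/setP=> -[[[s|s]|[h|[[s h] i]]] vx]; rewrite !inE /= /shrub_adj //= orbF.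
  by rewrite -val_eqE /= eq_sym.
have [[_ _ _ _] _ _ common _] := ho.
case: x deg1 => [[[t|t]|[h|[[t h] i]]] /= vx].
- by exists t; apply: val_inj.
- have /set0Pn[h] := common t t; rewrite !inE andbb => th.
  case/(@degree_gt1 _ (leaf_node t) (path_node th (Ordinal M_gt0))) => //;
    by rewrite /= /shrub_adj /= eqxx.
- have [t th] := existsP vx.
  have lt1 : 8 * c + 1 < M by lia. have lt2 : 8 * c + 2 < M by lia.
  have [_ le_w] := andP (weight_bounds t h).
  case/(@degree_gt1 _ (path_node th (Ordinal lt1)) (path_node th (Ordinal lt2))) => //.
  + by rewrite /= /shrub_adj /= eqxx le_w.
  + rewrite /= /shrub_adj /= eqxx /=; lia.
  by apply/eqP=> /(congr1 val) [] /eqP; lia.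
have [y xy y_lt] : exists2 y : shrub_graph,
    adj (path_node vx i) y &
    match val y with
    | inl _ => true
    | inr (inl _) => false
    | inr (inr (_, _, j)) => j < i
    end.
  case: i => -[|i] lt_i; first by exists (target_node t); rewrite //= /shrub_adj /= eqxx.
  exists (path_node vx (Ordinal (ltnW lt_i))) => //=.
  by rewrite /shrub_adj /= !eqxx orbT.
have [z xz z_gt] : exists2 z : shrub_graph,
    adj (path_node vx i) z &
    match val z with
    | inl _ => false
    | inr (inl _) => true
    | inr (inr (_, _, j)) => i < j
    end.
  have [lt_i|le_i] := ltnP i.+1 M.
    by exists (path_node vx (Ordinal lt_i)); rewrite //= /shrub_adj /= !eqxx.
  exists (hidden_node (valid_hidden vx)) => //=; rewrite /shrub_adj /= eqxx /=.
  by have := weight_bounds t h; have := ltn_ord i; lia.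
case/(degree_gt1 xy xz); apply/eqP=> eq_yz.
rewrite -{}eq_yz in z_gt; case: y y_lt z_gt {xy xz} => [[y|[y|[[t1 h1] j]]] vy] //=.
by lia.
Qed.

(** The dominant detour has length [6 + 2 * label h] modulo 4, a multiple of 4 iff the label is
    1. *)
Definition shrub_signature : {pred 'I_1 * 'I_1 * nat} :=
  [pred p | (0 < p.2 <= shrub_diameter) && (4 %| p.2)].

Lemma shrub_shrub : shrub_decomposition shrub_diameter G shrub_graph shrub_signature.
Proof.
split=> [i j l|i j l|x y|]; first by rewrite !inE => /andP[].
- by rewrite !inE.
- exact: shrub_diameterP.
exists leaf_node, (fun=> ord0); split.
- by move=> t t' [].
- exact: leaf_degree.
move=> t t' l dist_l; have [eq_tt'|ne_tt'] := eqVneq t t'.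
  rewrite eq_tt' adj_irr inE; case: dist_l => _ /(_ [::] isT); rewrite eq_tt'.
  by move=> /(_ erefl); rewrite leqn0 => /eqP->.
have [_ _ _ _ /(_ t t') dom] := ho; have [h [_ hN max_h]] := dom_ofP t t'.
have dist_h := distance_leaf ne_tt' hN max_h.
have [k le_k dist_k] := shrub_diameterP (leaf_node t) (leaf_node t').
rewrite (distance_fun dist_k dist_l) in le_k.
rewrite (dom h) // inE /= le_k andbT (distance_fun dist_l dist_h).
by rewrite /weight; case: (label h) => /=; lia.
Qed.

(** * Treewidth of the shrub graph *)

Let key (x : raw_node) : nat :=
  let P := (\max_(h : H) pi h).+1 in
  match x with
  | inl (inl _) => P.+1
  | inl (inr _) => P
  | inr (inl h) => pi h
  | inr (inr (_, _, i)) => P.+1 + i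
  end.

(** An inner vertex is linked to both ends of its path and to all earlier inner vertices: each path
    becomes a clique, at a cost that depends only on [c]. *)
Let raw_back (x : raw_node) : {set raw_node} :=
  match x with
  | inl (inl t) => [set x; raw_target t]
  | inl (inr t) => x |: raw_hidden @: N t
  | inr (inl h) => raw_hidden @: back h
  | inr (inr (t, h, i)) =>
      [set raw_target t; raw_hidden h] :|:
      raw_path t h @: [set j : 'I_(8 * c + 3) | j <= i]
  end.

Lemma raw_back_key x y : y \in raw_back x -> y = x \/ key y < key x.
Proof.
have [[inj _ le_back _] _ _ _ _] := ho.
have lt_pi h : pi h < (\max_(h : H) pi h).+1 by rewrite ltnS leq_bigmax.
case: x => [[t|t]|[h|[[t h] i]]] /=.
- by case/set2P=> ->; [left|right].
- by case/setU1P=> [->|/imsetP[h _ ->]]; [left|right; apply: lt_pi].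
- case/imsetP=> h' hh' ->; have := le_back _ _ hh'; rewrite leq_eqVlt.
  by case/predU1P=> [/inj->|lt_h]; [left|right].
case/setUP=> [/set2P[]->|/imsetP[j]]; first by right; rewrite /= addSn ltnS leq_addr.
  by right; rewrite /= (leq_trans (lt_pi h)) // addSn leqW // leq_addr.
rewrite inE leq_eqVlt => /predU1P[/val_inj->|lt_ji] ->; first by left.
by right; rewrite /= ltn_add2l.
Qed.

Lemma raw_back_refl x : x \in raw_back x.
Proof.
have [[_ refl _ _] _ _ _ _] := ho.
case: x => [[t|t]|[h|[[t h] i]]] /=; rewrite ?inE ?eqxx //.
  by rewrite mem_imset // => ? ? [].
by apply/orP; right; rewrite mem_imset ?inE // => ? ? [].
Qed.

Lemma raw_back_trans x y z : valid_node x -> y \in raw_back x -> z \in raw_back x ->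
  key y <= key z -> y = z \/ y \in raw_back z.
Proof.
have [[inj _ le_back tri] _ nested _ _] := ho.
have lt_pi h : pi h < (\max_(h : H) pi h).+1 by rewrite ltnS leq_bigmax.
move=> vx xy xz le_yz.
have [->|lt_zx] := raw_back_key xz; first by right.
have [eq_yx|lt_yx] := raw_back_key xy; first by move: le_yz; rewrite eq_yx leqNgt lt_zx.
case: x vx xy xz lt_zx lt_yx => [[t|t]|[h|[[t h] i]]] /= vx.
- by do 2![case/set2P=> ->]; rewrite ?ltnn //; left.
- case/setU1P=> [->|/imsetP[h hN eq_y]]; first by rewrite /= ltnn.
  case/setU1P=> [->|/imsetP[h' h'N eq_z]] _ _; right; rewrite eq_y.
    by rewrite /= !inE mem_imset ?hN ?orbT // => ? ? [].
  rewrite eq_z mem_imset => [|? ? [] //]; apply: nested hN h'N _.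
  by rewrite eq_y eq_z in le_yz.
- case/imsetP=> h1 hh1 eq_y /imsetP[h2 hh2 eq_z] _ _; right; rewrite eq_y eq_z.
  rewrite mem_imset => [|? ? [] //]; apply: tri hh1 hh2 _.
  by rewrite eq_y eq_z in le_yz.
case/setUP=> [/set2P[]eq_y|/imsetP[j ij eq_y]]
             /setUP[/set2P[]eq_z|/imsetP[k ik eq_z]] _ _;
  rewrite eq_y eq_z /= in le_yz *; (try by left); right; rewrite ?inE ?eqxx ?orbT //.
- by move: le_yz; rewrite leqNgt lt_pi.
- by rewrite mem_imset ?inE ?vx // => ? ? [].
- by move: le_yz; lia.
- move: le_yz; rewrite leqNgt (leq_trans (lt_pi h)) //.
  by rewrite addSn leqW // leq_addr.
apply/orP; right; rewrite mem_imset ?inE => [|? ? [] //].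
by move: le_yz; rewrite leq_add2l.
Qed.

Lemma card_raw_back x : #|raw_back x| <= (8 * c + 6).
Proof.
have [_ [card_back card_N] _ _ _] := ho.
case: x => [[t|t]|[h|[[t h] i]]] /=.
- by rewrite cards2; lia.
- apply: leq_trans (leq_card_setU _ _) _; rewrite cards1.
  apply: (@leq_trans (1 + c)); last by lia.
  by rewrite leq_add2l; apply: leq_trans (leq_imset_card _ _) (card_N t).
- apply: leq_trans (leq_imset_card _ _) _.
  by apply: leq_trans (card_back h) _; lia.
apply: leq_trans (leq_card_setU _ _) _; rewrite cards2 /=.
apply: (@leq_trans (2 + (8 * c + 3))); last by lia.
rewrite leq_add2l; apply: leq_trans (leq_imset_card _ _) _.
by apply: leq_trans (max_card _) _; rewrite card_ord.
Qed.

Lemma arc_back x y : valid_node x -> valid_node y -> arc x y ->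
  x \in raw_back y \/ y \in raw_back x.
Proof.
case: x y => [[t|t]|[h|[[t h] i]]] [[s|s]|[k|[[s k] j]]] //= vx vy.
- by move/eqP<-; right; rewrite !inE eqxx orbT.
- by case/andP=> /eqP<- _; left; rewrite !inE eqxx.
- by case/andP=> /eqP<- _; right; rewrite !inE eqxx orbT.
case/and3P=> /eqP<- /eqP<- /eqP eq_j; left; apply/setUP; right.
by rewrite mem_imset ?inE ?eq_j // => ? ? [].
Qed.

Lemma shrub_treewidth : treewidth_at_most shrub_diameter shrub_graph.
Proof.
pose pi' := linearize (fun x : shrub_graph => key (val x)).
pose back' (x : shrub_graph) : {set shrub_graph} := [set y | val y \in raw_back (val x)].
apply: (@chordal_treewidth _ pi' back').
- split=> [|x|y x|y x z]; first exact: linearize_inj.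
  + by rewrite inE raw_back_refl.
  + by rewrite inE => /raw_back_key[/val_inj-> //|lt_xy]; apply/ltnW/linearize_lt.
  rewrite !inE => xy xz /linearize_le le_yz.
  have [/val_inj->|//] := raw_back_trans (valP x) xy xz le_yz.
  exact: raw_back_refl.
- move=> x y; rewrite !inE => /orP[/arc_back|/arc_back].
    by apply; apply: valP.
  by move/(_ (valP y) (valP x))=> []; [right|left].
move=> x; apply: (@leq_trans (8 * c + 6)); last by rewrite /shrub_diameter; lia.
apply: leq_trans (card_raw_back (val x)).
rewrite -(card_imset _ val_inj); apply/subset_leq_card/subsetP=> _ /imsetP[y xy ->].
by rewrite inE in xy.
Qed.
End Shrub.

(** * Transductions of parity- and shrub-decompositions *)

Section Formulas.
Variables (U B : Type).

Definition fo_true n : fo U B n := FONot (FOFalse U B n).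

Definition fo_any n (fs : seq (fo U B n)) : fo U B n :=
  foldr (@FOOr U B n) (FOFalse U B n) fs.

Definition fo_all n (fs : seq (fo U B n)) : fo U B n :=
  foldr (@FOAnd U B n) (fo_true n) fs.

Lemma sat_ex (A : structure U B) n (f : fo U B n.+1) (e : n.-tuple A) :
  sat (FOEx f) e = [exists a : A, sat f [tuple of a :: e]].
Proof. by []. Qed.

Lemma sat_and (A : structure U B) n (f g : fo U B n) (e : n.-tuple A) :
  sat (FOAnd f g) e = sat f e && sat g e.
Proof. by []. Qed.

Lemma sat_not (A : structure U B) n (f : fo U B n) (e : n.-tuple A) :
  sat (FONot f) e = ~~ sat f e.
Proof. by []. Qed.

Lemma sat_any (A : structure U B) n fs (e : n.-tuple A) :
  sat (fo_any fs) e = has (fun f => sat f e) fs.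
Proof. by elim: fs => //= f fs ->. Qed.

Lemma sat_all (A : structure U B) n fs (e : n.-tuple A) :
  sat (fo_all fs) e = all (fun f => sat f e) fs.
Proof. by elim: fs => //= f fs ->. Qed.
End Formulas.

Section CopyFormulas.
Variables (p : nat).
Local Notation formula := (fo ('I_p + 'I_1) (option unit)).

Definition fo_adj n (x y : 'I_n) : formula n := FOBin _ (Some tt) x y.

Fixpoint fo_walk l n (x y : 'I_n) : formula n :=
  if l is l'.+1 then
    FOEx (FOAnd (fo_adj (lift ord0 x) ord0) (fo_walk l' ord0 (lift ord0 y)))
  else FOEq _ _ x y.

Definition fo_distance l n (x y : 'I_n) : formula n :=
  FOAnd (fo_walk l x y) (fo_all [seq FONot (fo_walk k x y) | k <- iota 0 l]).

Fixpoint fo_common_ge j n (x y : 'I_n) (zs : seq 'I_n) : formula n :=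
  if j is j'.+1 then
    FOEx (FOAnd (FOAnd (fo_adj (lift ord0 x) ord0) (fo_adj (lift ord0 y) ord0))
         (FOAnd (fo_all [seq FONot (FOEq _ _ ord0 (lift ord0 z)) | z <- zs])
                (fo_common_ge j' (lift ord0 x) (lift ord0 y)
                   (ord0 :: [seq lift ord0 z | z <- zs]))))
  else fo_true _ _ n.

Variables (G : sgraph) (P : 'I_p -> pred G).
Local Notation A := (copy 1 (expansion P)).

Lemma sat_adj n (x y : 'I_n) (e : n.-tuple A) :
  sat (fo_adj x y) e = adj (tnth e x).1 (tnth e y).1.
Proof. by rewrite /= [_.2]ord1 [X in _ == X]ord1 eqxx. Qed.

Lemma copy1_eq (a b : A) : (a == b) = (a.1 == b.1).
Proof. by rewrite -pair_eqE /= [a.2]ord1 [b.2]ord1 eqxx andbT. Qed.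

Lemma sat_walk l n (x y : 'I_n) (e : n.-tuple A) :
  sat (fo_walk l x y) e <-> walk (tnth e x).1 (tnth e y).1 l.
Proof.
elim: l n x y e => [|l IHl] n x y e.
  rewrite /= copy1_eq; split=> [/eqP->|[[|z q] []//= _ /eqP //]]; exact: walk0.
rewrite [fo_walk _ _ _]/= sat_ex; split.
  case/existsP=> a; rewrite sat_and sat_adj tnthS tnth0.
  case/andP=> xa /IHl; rewrite tnthS tnth0; move/walk1: xa => /walk_trans; apply.
case=> -[|z q] [xq lastq size_q] //; move: xq size_q => /andP[xz zq] [size_q].
apply/existsP; exists (z, ord0); rewrite sat_and sat_adj tnthS tnth0 xz /=.
by apply/IHl; rewrite tnthS tnth0; exists q.
Qed.

Lemma sat_distance l n (x y : 'I_n) (e : n.-tuple A) :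
  sat (fo_distance l x y) e <-> distance (tnth e x).1 (tnth e y).1 l.
Proof.
rewrite sat_and sat_all all_map; split.
  case/andP=> /sat_walk xy /allP short; split=> // q xq lastq.
  rewrite leqNgt; apply/negP=> lt_q.
  move: (short (size q)); rewrite mem_iota add0n lt_q => /(_ isT)/negP[].
  by apply/sat_walk; exists q.
case=> /sat_walk-> min_l /=; apply/allP=> k; rewrite mem_iota add0n => /= lt_k.
apply/negP=> /sat_walk[q [xq lastq size_q]].
by have := min_l q xq lastq; rewrite size_q leqNgt lt_k.
Qed.

Lemma sat_common_ge j n (x y : 'I_n) zs (e : n.-tuple A) :
  sat (fo_common_ge j x y zs) e =
  (j <= #|(nbh (tnth e x).1 :&: nbh (tnth e y).1)
          :\: [set z in [seq (tnth e z).1 | z <- zs]]|).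
Proof.
elim: j n x y zs e => [|j IHj] n x y zs e //.
rewrite [fo_common_ge _ _ _ _]/= sat_ex.
set X := nbh _ :&: nbh _; set Z := [set z in _].
have sat_new (a : A) :
    sat (fo_all [seq FONot (FOEq _ _ ord0 (lift ord0 z)) | z <- zs])
      [tuple of a :: e] = (a.1 \notin Z).
  rewrite sat_all all_map inE; elim: (zs) => //= z zs' ->.
  by rewrite tnth0 tnthS copy1_eq inE negb_or.
have sat_rest (a : A) :
    sat (fo_common_ge j (lift ord0 x) (lift ord0 y)
           (ord0 :: [seq lift ord0 z | z <- zs])) [tuple of a :: e] =
    (j <= #|(X :\: Z) :\ a.1|).
  rewrite IHj !tnthS; congr (_ <= _); apply: eq_card => b.
  rewrite map_cons tnth0 !inE negb_or -map_comp -andbA; congr [&& _, _ & _].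
  by congr (~~ (_ \in _)); apply: eq_map => z /=; rewrite tnthS.
apply/existsP/idP => [[a]|].
  rewrite !sat_and !sat_adj sat_new sat_rest !tnthS tnth0.
  case/and3P=> /andP[xa ya] aZ; rewrite (cardsD1 a.1 (X :\: Z)).
  by rewrite in_setD aZ !inE xa ya.
move=> lt_j; have /card_gt0P[z zS] : 0 < #|X :\: Z| by apply: leq_ltn_trans lt_j.
exists (z, ord0); rewrite !sat_and !sat_adj sat_new sat_rest !tnthS tnth0.
move: lt_j; rewrite (cardsD1 z) zS; move: zS; rewrite in_setD !inE /=.
by case/and3P=> -> -> ->.
Qed.

Definition fo_odd_common d n (x y : 'I_n) : formula n :=
  fo_any [seq FOAnd (fo_common_ge j x y [::]) (FONot (fo_common_ge j.+1 x y [::]))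
         | j <- iota 0 d.+1 & odd j].

Lemma sat_odd_common d n (x y : 'I_n) (e : n.-tuple A) :
  #|nbh (tnth e x).1 :&: nbh (tnth e y).1| <= d ->
  sat (fo_odd_common d x y) e = odd #|nbh (tnth e x).1 :&: nbh (tnth e y).1|.
Proof.
set X := _ :&: _ => le_d; rewrite sat_any has_map.
have sat_j j : sat (FOAnd (fo_common_ge j x y [::])
                          (FONot (fo_common_ge j.+1 x y [::]))) e = (j == #|X|).
  rewrite sat_and sat_not !sat_common_ge.
  rewrite (_ : _ :\: _ = X); last by apply/setP=> z; rewrite !inE.
  by rewrite -leqNgt -eqn_leq.
apply/hasP/idP=> [[j] | odd_X].
  by rewrite mem_filter /= => /andP[odd_j _]; have /= -> := sat_j j; move/eqP<-.
exists #|X|; first by rewrite mem_filter odd_X mem_iota.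
by have /= -> := sat_j #|X|.
Qed.
End CopyFormulas.

Definition marked_transduction (phi : fo ('I_1 + 'I_1) (option unit) 2) :
    transduction :=
  @Transduction 1 1 (BasicTransduction (fo_true _ _ 0) (FOUn _ (inl ord0) ord0) phi).

Lemma transduce_marked (C : graph_class) phi (G G' : sgraph) (iota : G -> G') :
  C G' -> injective iota ->
  (forall (P : 'I_1 -> pred G') u v, u != v ->
     sat (A := copy 1 (expansion P)) phi [tuple (iota u, ord0); (iota v, ord0)] =
     adj u v) ->
  transduce (marked_transduction phi) C G.
Proof.
move=> CG' inj sat_phi; exists G', (fun=> [pred x | x \in codom iota]).
set P := fun=> _; set A := copy 1 (expansion P); split=> //.
have nuP v : sat (A := A) (nu (basic (marked_transduction phi))) [tuple (iota v, ord0)].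
  by rewrite /= /P /= codom_f.
pose f (v : G) : basic_graph (basic (marked_transduction phi)) A :=
  Sub (iota v, ord0) (nuP v).
have inj_f : injective f by move=> u v /(congr1 val) [] /inj.
have surj x : exists v, f v = x.
  case: x => [[x i] nu_x]; have /codomP[v eq_x] : x \in codom iota by apply: nu_x.
  by exists v; apply: val_inj; rewrite /= eq_x [i]ord1.
exists f.
  apply: inj_card_bij => //; rewrite -(card_codom inj_f).
  by apply/subset_leq_card/subsetP=> x _; have [v <-] := surj x; apply: codom_f.
move=> u v; rewrite /= /basic_adj (inj_eq inj_f).
have [->|ne_uv] := eqVneq u v; first by rewrite adj_irr.
by rewrite /= !sat_phi ?(adj_sym v u) ?orbb // eq_sym.
Qed.

Lemma parity_transduction (C' : graph_class) d (G : sgraph) (H : finType)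
    (B : G -> H -> bool) :
  parity_decomposition d B -> C' (bip_graph B) ->
  transduce (marked_transduction (fo_odd_common 1 d ord0 (lift ord0 ord0))) C' G.
Proof.
move=> [le_d parity] C'B.
apply: (transduce_marked (G' := bip_graph B) (iota := inl)) => //.
  by move=> ? ? [].
move=> P u v ne_uv; rewrite (parity u v ne_uv) sat_odd_common //.
by apply: leq_trans (le_d u); apply/subset_leq_card/subsetIl.
Qed.

(** The disjunction runs up to [t] rather than [d], so that one transduction serves the whole
    class. *)
Lemma shrub_transduction (C' : graph_class) t d (G F : sgraph) S :
  d <= t -> shrub_decomposition (m := 1) d G F S -> C' F ->
  transduce (marked_transduction
    (fo_any [seq fo_distance 1 l ord0 (lift ord0 ord0)
            | l <- iota 0 t.+1 & (ord0, ord0, l) \in S])) C' G.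
Proof.
move=> le_dt [_ _ dist [leaf [color [inj _ adjE]]]] C'F.
apply: (transduce_marked (iota := leaf)) => // P u v _.
have [l le_l dist_l] := dist (leaf u) (leaf v).
rewrite (adjE _ _ _ dist_l) [color u]ord1 [color v]ord1 sat_any has_map.
apply/hasP/idP=> [[k]|lS].
  by rewrite mem_filter => /andP[kS _] /sat_distance/(distance_fun dist_l)->.
exists l; last exact/sat_distance.
by rewrite mem_filter lS mem_iota /= ltnS (leq_trans le_l).
Qed.

(** * Quantifier elimination along a chordal order *)

Section Kernel.
Variables (A V : finType) (Y : A -> {set V}).

(* A set that meets [Y a] contains some [z] in [Y a], so that only the members
   avoiding [z] matter, with a budget reduced by one. *)
Fixpoint kernel (N : nat) (S : {set A}) : seq A :=
  if [pick a in S] is Some a then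
    a :: if N is N'.+1 then
           flatten [seq kernel N' [set b in S | z \notin Y b] | z <- enum (Y a)]
         else [::]
  else [::].

Fixpoint kernel_bound (M N : nat) : nat :=
  if N is N'.+1 then (M * kernel_bound M N').+1 else 1.

Lemma kernel_sub N (S : {set A}) a : a \in kernel N S -> a \in S.
Proof.
elim: N S => [|N IHN] S /=; case: pickP => // b Sb; rewrite inE.
  by move/eqP->.
by case/predU1P=> [-> //|/flatten_mapP[z _ /IHN]]; rewrite inE => /andP[].
Qed.

Lemma size_kernel M N (S : {set A}) :
  (forall a, #|Y a| <= M) -> size (kernel N S) <= kernel_bound M N.
Proof.
move=> le_M; elim: N S => [|N IHN] S /=; case: pickP => // b Sb; rewrite /= ltnS.
have le_sum (s : seq V) : size (flatten
    [seq kernel N [set a in S | z \notin Y a] | z <- s]) <= size s * kernel_bound M N.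
  elim: s => //= z s IHs; rewrite size_cat mulSn.
  exact: leq_add.
apply: leq_trans (le_sum _) _; rewrite leq_mul2r -cardE.
by rewrite le_M orbT.
Qed.

(** Whether some member of [S] misses a given small set can thus be tested on a list of bounded
    length. If the first element of the list meets [X] in [z], then [a] survives among the members
    missing [z], and [X :\ z] is smaller. *)
Lemma kernelP N (S : {set A}) (X : {set V}) a :
  #|X| <= N -> a \in S -> [disjoint Y a & X] ->
  exists2 b, b \in kernel N S & [disjoint Y b & X].
Proof.
elim: N S X => [|N IHN] S X /=; case: pickP => [b Sb|/(_ a) /= -> //] le_N Sa aX.
  exists b; first exact: mem_head.
  by move: le_N; rewrite leqn0 cards_eq0 => /eqP->; rewrite -setI_eq0 setI0.
have [bX|] := boolP [disjoint Y b & X]; first by exists b; rewrite ?mem_head.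
rewrite -setI_eq0 => /set0Pn[z /setIP[bz zX]].
have [|||d d_ker dX] := IHN [set b in S | z \notin Y b] (X :\ z).
- by rewrite (cardsD1 z) zX in le_N.
- by rewrite inE Sa (disjointFl aX zX).
- by apply: disjointWr aX; apply: subD1set.
exists d.
  rewrite inE; apply/orP; right; apply/flatten_mapP.
  by exists z; rewrite ?mem_enum.
have := kernel_sub d_ker; rewrite inE => /andP[_ zd].
apply/pred0P=> x /=; apply/negbTE/negP=> /andP[xd xX].
have [eq_xz|ne_xz] := eqVneq x z; first by rewrite eq_xz (negPf zd) in xd.
by have := disjointFr dX xd; rewrite !inE ne_xz xX.
Qed.
End Kernel.

Section Words.
Variables (k : nat) (V : finType) (back : V -> {set V}).

(** These [k] unary functions name the members of [back v]. An index out of range returns [v],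
    itself in [back v] for a chordal order. *)
Definition back_step (v : V) (i : 'I_k) : V := nth v (enum (back v)) i.

Definition ev (a : seq 'I_k) (v : V) : V := foldl back_step v a.

Lemma ev_cat a b v : ev (a ++ b) v = ev b (ev a v).
Proof. exact: foldl_cat. Qed.

Variables (pi : V -> nat).
Hypotheses (ch : chordal_order pi back) (le_k : forall v, #|back v| <= k).

Lemma back_stepP v i : back_step v i \in back v.
Proof.
have [_ refl _ _] := ch; rewrite /back_step.
have [lt_i|le_i] := ltnP i (size (enum (back v))).
  by rewrite -mem_enum mem_nth.
by rewrite nth_default.
Qed.

Lemma back_step_ex v u : u \in back v -> exists i, back_step v i = u.
Proof.
move=> vu; have lt_i : index u (enum (back v)) < k.
  by apply: leq_trans (le_k v); rewrite cardE index_mem mem_enum.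
by exists (Ordinal lt_i); rewrite /back_step nth_index // mem_enum.
Qed.

Lemma ev_anc R a v : size a <= R -> ev a v \in anc back R v.
Proof.
elim: R a v => [|R IHR] [|i a] v //=; first by rewrite inE.
  by move=> _; apply: (anc_refl ch R.+1).
by move=> le_R; apply/ancSP; exists (back_step v i); [exact: back_stepP|exact: IHR].
Qed.

Lemma anc_ev R v u : u \in anc back R v -> exists2 a, size a <= R & ev a v = u.
Proof.
elim: R v => [|R IHR] v; first by rewrite inE => /eqP->; exists [::].
case/ancSP=> x /back_step_ex[i <-] /IHR[a le_R <-].
by exists (i :: a).
Qed.
End Words.

(** * Extending similar tuples by one element *)

Section Extension.
Variables (k : nat) (A V : finType) (iota : A -> V) (pi : V -> nat).
Variables (back : V -> {set V}) (root : V).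

(** [V] may exceed the domain, so that an artificial [root] can provide a common ancestor for any
    two elements. *)
Definition guarded (U B : Type) (S : structure U B) (iota : S -> V) : Prop :=
  [/\ injective iota, chordal_order pi back,
      forall v, #|back v| <= k, forall v, root \in back v
    & forall b x y, binary b x y ->
        iota x \in back (iota y) \/ iota y \in back (iota x)].

Local Notation ev := (@ev k V back).

Definition similar (R : nat) (K : Type) (col : A -> K) n (x x' : n.-tuple A) :=
  (forall i, col (tnth x i) = col (tnth x' i)) /\
  forall i j (a b : seq 'I_k), size a <= R -> size b <= R ->
    (ev a (iota (tnth x i)) == ev b (iota (tnth x j))) =
    (ev a (iota (tnth x' i)) == ev b (iota (tnth x' j))).

Lemma similar_sym R K (col : A -> K) n (x x' : n.-tuple A) :
  similar R col x x' -> similar R col x' x.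
Proof. by case=> eq_c eq_p; split=> [i|i j a b le_a le_b]; rewrite ?eq_p. Qed.

Lemma similar_weaken R1 R2 K1 K2 (col1 : A -> K1) (col2 : A -> K2)
    n (x x' : n.-tuple A) :
  R1 <= R2 -> (forall a b, col2 a = col2 b -> col1 a = col1 b) ->
  similar R2 col2 x x' -> similar R1 col1 x x'.
Proof.
move=> le_R col12 [eq_c eq_p]; split=> [i|i j a b le_a le_b]; first exact/col12.
by apply: eq_p; apply: leq_trans le_R.
Qed.

Variables (R n : nat) (K : finType).

Local Notation word := {bseq R of 'I_k}.

(* The type of [y] relative to [w]: its colour, the coincidences among its own
   ancestors, and those between ancestors of [y] and ancestors of [w]. *)
Definition ptype : finType := (K * {set word * word} * {set word * word})%type.

(** An element has at most [k ^ R] ancestors, and an [n]-tuple at most [n * k ^ R]: these bound the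
    sets of the kernel and the set to be avoided. *)
Definition kernel_size : nat := kernel_bound (k ^ R) (n * k ^ R).

Definition ext_color : finType :=
  (K * {ffun word -> {set ptype * 'I_kernel_size} *
                     {set word * ptype * 'I_kernel_size * word}})%type.

Variable col : A -> K.
Local Notation W := (anc back R).

Definition coincidences (v w : V) : {set word * word} :=
  [set p : word * word | ev p.1 v == ev p.2 w].

Definition ptype_of (y : A) (w : V) : ptype :=
  (col y, coincidences (iota y) (iota y), coincidences (iota y) w).

(** Representatives of the elements of type [t] above [w]: if such an element shares with an
    [n]-tuple only ancestors of [w], then so does a representative. *)
Definition witnesses (w : V) (t : ptype) : seq A :=
  kernel (fun y => W (iota y) :\: W w) (n * k ^ R)
    [set y | (ptype_of y w == t) && (w \in W (iota y))].

Definition present (w : V) : {set ptype * 'I_kernel_size} :=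
  [set p : ptype * 'I_kernel_size | p.2 < size (witnesses w p.1)].

(** Records how [u] is an ancestor of the representatives attached to its own ancestors, so that
    colours reveal where a representative meets a tuple. *)
Definition role (u : V) : {set word * ptype * 'I_kernel_size * word} :=
  [set p : word * ptype * 'I_kernel_size * word | let: (c, t, i, b) := p in
    if onth (witnesses (ev c u) t) i is Some y then ev b (iota y) == u else false].

Definition ext_col (x : A) : ext_color :=
  (col x, [ffun a : word => (present (ev a (iota x)), role (ev a (iota x)))]).

Hypotheses (ch : chordal_order pi back).
Hypotheses (le_k : forall v, #|back v| <= k) (rootP : forall v, root \in back v).
Hypothesis R_gt0 : 0 < R.

Lemma coincidencesP v w v' w' a b : coincidences v w = coincidences v' w' ->
  size a <= R -> size b <= R -> (ev a v == ev b w) = (ev a v' == ev b w').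
Proof.
move=> eq_c le_a le_b.
by have /setP/(_ (Bseq le_a, Bseq le_b)) := eq_c; rewrite !inE.
Qed.

(** Let [w] be the largest common ancestor of [y] and the tuple [x]. There is a representative [b]
    of the same type at [w] that meets [x] only in ancestors of [w]; [y'] is the representative at
    the same position of the list at [w'], the counterpart of [w]. All coincidences of [y'] with
    [x'] lie among ancestors of [w'], where the type decides them. *)
Lemma similar_extend (x x' : n.-tuple A) y :
  similar (R + R) ext_col x x' ->
  exists y', similar R col [tuple of y :: x] [tuple of y' :: x'].
Proof.
(* With an empty tuple there is no [w], and [y] itself serves. *)
move=> [eq_c eq_p]; case: (posnP n) => [n0 | n_gt0].
  have -> : x' = x by apply: eq_from_tnth => i; have := ltn_ord i; rewrite {2}n0.
  by exists y; split.
have [pi_inj _ _ _] := ch.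
have root_W v : root \in W v by apply: (back_sub_anc ch).
pose X := \bigcup_(i < n) W (iota (tnth x i)).
pose i1 := Ordinal n_gt0.
have rootYX : root \in W (iota y) :&: X.
  by rewrite inE root_W; apply/bigcupP; exists i1.
have [w] := @arg_maxnP _ root (fun u => u \in W (iota y) :&: X) pi rootYX.
case/setIP=> yw /bigcupP[i0 _ i0w] max_w.
have YX_w u : u \in W (iota y) -> u \in X -> u \in W w.
  by move=> yu uX; apply: (anc_anc ch yu yw); apply: max_w; rewrite inE yu.
have [a0 le_a0 eq_w] := anc_ev le_k i0w.
pose w' := ev a0 (iota (tnth x' i0)).
have leRR s : size s <= R -> size s <= R + R by move/leq_trans; apply; apply: leq_addr.
have leDD s s' : size s <= R -> size s' <= R -> size (s ++ s') <= R + R.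
  by move=> *; rewrite size_cat leq_add.
(* As [w] is itself reached by a word of length at most [R], comparing with its ancestors takes
   words of length up to [R + R]. *)
have transfer j a c : size a <= R -> size c <= R ->
    (ev a (iota (tnth x j)) == ev c w) = (ev a (iota (tnth x' j)) == ev c w').
  move=> le_a le_c; rewrite -eq_w /w' -!ev_cat.
  by apply: eq_p; [apply: leRR | apply: leDD].
have transfer_w j a c : size a <= R -> size c <= R ->
    (ev c (ev a (iota (tnth x j))) == w) = (ev c (ev a (iota (tnth x' j))) == w').
  move=> le_a le_c; rewrite -eq_w /w' -!ev_cat.
  by apply: eq_p; [apply: leDD | apply: leRR].
have color j (a : seq 'I_k) : size a <= R ->
    present (ev a (iota (tnth x j))) = present (ev a (iota (tnth x' j))) /\
    role (ev a (iota (tnth x j))) = role (ev a (iota (tnth x' j))).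
  move=> le_a; have /(congr1 snd)/ffunP/(_ (Bseq le_a)) := eq_c j.
  by rewrite !ffunE => -[].
have ev_W a v : size a <= R -> ev a v \in W v by exact: (ev_anc ch).
have XP u :
  reflect (exists j, exists2 a, size a <= R & ev a (iota (tnth x j)) = u) (u \in X).
  apply: (iffP bigcupP) => [[j _ /(anc_ev le_k)[a]]|[j [a le_a <-]]].
    by exists j, a.
  by exists j => //; apply: ev_W.
pose t := ptype_of y w.
have [b b_ker bX] : exists2 b, b \in witnesses w t & [disjoint W (iota b) :\: W w & X].
  apply: (@kernelP _ _ _ _ _ _ y); last 1 first.
  - apply/pred0P=> u /=; apply/negbTE/negP=> /andP[/setDP[yu wu] uX].
    by rewrite YX_w in wu.
  - have /card_bigcup_le/leq_trans-> // : forall j, #|W (iota (tnth x j))| <= k ^ R.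
      by move=> j; apply: card_anc.
    by rewrite card_ord.
  by rewrite inE eqxx yw.
have lt_b : index b (witnesses w t) < kernel_size.
  apply: (@leq_trans (size (witnesses w t))); first by rewrite index_mem.
  apply: size_kernel => a; apply: leq_trans (card_anc R (iota a) le_k).
  exact/subset_leq_card/subsetDl.
pose i := Ordinal lt_b.
have onth_b : onth (witnesses w t) i = Some b.
  by rewrite onthE (nth_map b) ?nth_index ?index_mem.
have : (t, i) \in present w' by rewrite -(color i0 _ le_a0).1 eq_w inE index_mem.
rewrite inE /= => lt_i; pose y' := nth b (witnesses w' t) i.
have onth_y' : onth (witnesses w' t) i = Some y' by rewrite onthE (nth_map b).
have := kernel_sub (mem_nth b lt_i); rewrite -/y' inE => /andP[/eqP ty' y'w'].
have tb : ptype_of b w = t.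
  by have := kernel_sub b_ker; rewrite inE => /andP[/eqP].
have [eq_col eq_own eq_rel] : [/\ col y' = col y,
    coincidences (iota y') (iota y') = coincidences (iota y) (iota y) &
    coincidences (iota y') w' = coincidences (iota y) w] by case: ty'.
have eq_relb : coincidences (iota b) w = coincidences (iota y') w'.
  by rewrite eq_rel; case: tb.
(* If [u'] were outside [W w'], its role would make the corresponding [u] an ancestor of [b]. By the
   choice of [b] this [u] lies in [W w], and the common type of [b] and [y'] carries that over to
   [u'] and [w']. *)
have y'X' j a u' : size a <= R -> ev a (iota (tnth x' j)) = u' ->
    u' \in W (iota y') -> u' \in W w'.
  move=> le_a eq_u' y'u'; apply: contraT => w'u'.
  have le_w' : pi w' <= pi u'.
    rewrite leqNgt; apply: contra w'u' => /ltnW.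
    exact: (anc_anc ch) y'u' y'w'.
  have [c le_c eq_cu'] := anc_ev le_k (anc_anc ch y'w' y'u' le_w').
  have [d le_d eq_du'] := anc_ev le_k y'u'.
  pose u := ev a (iota (tnth x j)).
  have eq_cu : ev c u = w.
    by apply/eqP; rewrite transfer_w // eq_u' eq_cu'.
  have : (Bseq le_c, t, i, Bseq le_d) \in role u.
    by rewrite (color j _ le_a).2 eq_u' inE /= eq_cu' onth_y' eq_du'.
  rewrite inE /= eq_cu onth_b => /eqP eq_db.
  have uX : u \in X by apply/XP; exists j, a.
  have := disjointFl bX uX; rewrite inE -{2}eq_db ev_W // andbT => /negbFE.
  case/(anc_ev le_k)=> e le_e eq_ew; have := coincidencesP eq_relb le_d le_e.
  rewrite eq_db eq_ew eqxx eq_du' => /esym/eqP eq_ew'.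
  by rewrite eq_ew' ev_W in w'u'.
have cross j a d : size a <= R -> size d <= R ->
    (ev a (iota (tnth x j)) == ev d (iota y)) =
    (ev a (iota (tnth x' j)) == ev d (iota y')).
  move=> le_a le_d; apply/eqP/eqP => eq_u.
    have : ev d (iota y) \in W w.
      by apply: YX_w; [exact: ev_W | apply/XP; exists j, a].
    case/(anc_ev le_k)=> e le_e eq_e.
    transitivity (ev e w'); first by apply/eqP; rewrite -transfer // eq_u eq_e.
    by apply/esym/eqP; rewrite (coincidencesP eq_rel) // eq_e.
  have := y'X' j a _ le_a eq_u (ev_W _ _ le_d).
  case/(anc_ev le_k)=> e le_e eq_e.
  transitivity (ev e w); first by apply/eqP; rewrite transfer // eq_u eq_e.
  by apply/esym/eqP; rewrite -(coincidencesP eq_rel) // eq_e.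
exists y'; split=> [j|j1 j2 a d le_a le_d].
  have [j' ->|->] := unliftP ord0 j; last by rewrite !tnth0.
  by rewrite !tnthS; have /(congr1 fst) := eq_c j'.
have [j1' ->|->] := unliftP ord0 j1; have [j2' ->|->] := unliftP ord0 j2;
  rewrite !(tnthS, tnth0).
- by apply: eq_p; apply: leRR.
- exact: cross.
- by rewrite eq_sym cross // eq_sym.
by rewrite (coincidencesP eq_own).
Qed.
End Extension.

Section Locality.
Variables (U B : Type) (k : nat).

Definition local_formula n (f : fo U B n) (R : nat) (K : finType) : Prop :=
  forall (A : structure U B) (V : finType) (iota : A -> V) (pi : V -> nat)
    (back : V -> {set V}) (root : V),
  guarded k pi back root iota ->
  exists col : A -> K, forall x x' : n.-tuple A,
    @similar k A V iota back R K col n x x' -> sat f x = sat f x'.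

Lemma quantifier_extend n (f : fo U B n.+1) (R : nat) (K : finType) :
  local_formula f R K -> exists R' (K' : finType),
  forall (A : structure U B) (V : finType) (iota : A -> V) (pi : V -> nat)
    (back : V -> {set V}) (root : V),
  guarded k pi back root iota ->
  exists col : A -> K', forall x x' : n.-tuple A,
    @similar k A V iota back R' K' col n x x' ->
    forall a, exists a', sat f [tuple of a :: x] = sat f [tuple of a' :: x'].
Proof.
(* The radius is made positive because reaching the root takes one step of [back]. *)
move=> loc; exists (R.+1 + R.+1), (ext_color k R.+1 n K).
move=> A V iota pi back root gA; have [col loc_col] := loc _ _ _ _ _ _ gA.
have [_ ch le_k rootP _] := gA.
exists (ext_col k iota back R.+1 n col) => x x' sim a.
have [a' sim'] := similar_extend ch le_k rootP (ltn0Sn R) a sim.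
by exists a'; apply: loc_col; apply: similar_weaken sim'.
Qed.

Lemma fo_local n (f : fo U B n) : exists R (K : finType), local_formula f R K.
Proof.
elim: n / f => [n|n x y|n P x|n b x y|n f [R [K loc]]
               |n f [R1 [K1 loc1]] g [R2 [K2 loc2]]
               |n f [R1 [K1 loc1]] g [R2 [K2 loc2]]
               |n f [R [K loc]]|n f [R [K loc]]].
- by exists 0, unit => A *; exists (fun=> tt).
- exists 0, unit => A V iota pi back root [inj _ _ _ _].
  exists (fun=> tt) => e e' [_ /(_ x y [::] [::] isT isT)] /=.
  by rewrite !(inj_eq inj).
- exists 0, bool => A V iota pi back root _.
  by exists (unary P) => e e' [eq_c _] /=.
(* One end of an edge lies in [back] of the other; the colour of that other end records, for each
   direction, the indices at which a neighbour is found. *)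
- exists 1, ({set 'I_k} * {set 'I_k})%type => A V iota pi back root [inj ch le_k _ guard].
  pose bout (v : A) (i : 'I_k) :=
    [exists u, (iota u == back_step back (iota v) i) && binary b v u].
  pose bin (v : A) (i : 'I_k) :=
    [exists u, (iota u == back_step back (iota v) i) && binary b u v].
  exists (fun v => ([set i : 'I_k | bout v i], [set i : 'I_k | bin v i])).
  suff imp e e' : similar k iota back 1
      (fun v => ([set i : 'I_k | bout v i], [set i : 'I_k | bin v i])) e e' ->
      sat (A := A) (FOBin U b x y) e -> sat (A := A) (FOBin U b x y) e'.
    by move=> e e' sim; apply/idP/idP; apply: imp => //; apply: similar_sym.
  move=> [eq_c eq_p] /= xy; case: (guard _ _ _ xy) => /(back_step_ex le_k)[i eq_i].
    have [_ /setP/(_ i)] := eq_c y; rewrite !inE => eq_bin.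
    have : bin (tnth e y) i by apply/existsP; exists (tnth e x); rewrite eq_i eqxx.
    rewrite eq_bin => /existsP[u /andP[/eqP eq_u uy]].
    have := eq_p y x [:: i] [::] isT isT; rewrite /= eq_i eqxx => /esym/eqP eq_x.
    by rewrite -eq_u in eq_x; rewrite -(inj _ _ eq_x).
  have [/setP/(_ i) + _] := eq_c x; rewrite !inE => eq_bout.
  have : bout (tnth e x) i by apply/existsP; exists (tnth e y); rewrite eq_i eqxx.
  rewrite eq_bout => /existsP[u /andP[/eqP eq_u xu]].
  have := eq_p x y [:: i] [::] isT isT; rewrite /= eq_i eqxx => /esym/eqP eq_y.
  by rewrite -eq_u in eq_y; rewrite -(inj _ _ eq_y).
- exists R, K => A V iota pi back root /loc[col loc_col].
  by exists col => x x' /loc_col /= ->.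
- exists (maxn R1 R2), (K1 * K2)%type => A V iota pi back root gA.
  have [col1 loc_1] := loc1 _ _ _ _ _ _ gA; have [col2 loc_2] := loc2 _ _ _ _ _ _ gA.
  exists (fun v => (col1 v, col2 v)) => x x' sim /=; congr (_ && _).
    by apply: loc_1; apply: similar_weaken sim => [|? ? []//]; apply: leq_maxl.
  by apply: loc_2; apply: similar_weaken sim => [|? ? []//]; apply: leq_maxr.
- exists (maxn R1 R2), (K1 * K2)%type => A V iota pi back root gA.
  have [col1 loc_1] := loc1 _ _ _ _ _ _ gA; have [col2 loc_2] := loc2 _ _ _ _ _ _ gA.
  exists (fun v => (col1 v, col2 v)) => x x' sim /=; congr (_ || _).
    by apply: loc_1; apply: similar_weaken sim => [|? ? []//]; apply: leq_maxl.
  by apply: loc_2; apply: similar_weaken sim => [|? ? []//]; apply: leq_maxr.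
- have [R' [K' ext]] := quantifier_extend loc; exists R', K'.
  move=> A V iota pi back root /ext[col ext_col]; exists col => x x' sim /=.
  apply/existsP/existsP => -[a fa].
    by have [a' eq_f] := ext_col _ _ sim a; exists a'; rewrite -eq_f.
  by have [a' eq_f] := ext_col _ _ (similar_sym sim) a; exists a'; rewrite -eq_f.
have [R' [K' ext]] := quantifier_extend loc; exists R', K'.
move=> A V iota pi back root /ext[col ext_col]; exists col => x x' sim /=.
apply/forallP/forallP => fa a.
  by have [a' ->] := ext_col _ _ (similar_sym sim) a.
by have [a' ->] := ext_col _ _ sim a.
Qed.
End Locality.

(** * From transductions to lacon-decompositions *)

Lemma eq_set2 (T : finType) (a b c d : T) : [set a; b] = [set c; d] ->
  a = c /\ b = d \/ a = d /\ b = c.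
Proof.
move=> eq_ab; have : a \in [set c; d] by rewrite -eq_ab set21.
have : b \in [set c; d] by rewrite -eq_ab set22.
have : c \in [set a; b] by rewrite eq_ab set21.
have : d \in [set a; b] by rewrite eq_ab set22.
by do 4![case/set2P=> ?]; subst; auto.
Qed.

Section LaconConstruction.
Variables (U B : Type) (A : structure U B) (V : finType) (iota : A -> V).
Variables (pi : V -> nat) (back : V -> {set V}) (root : V) (k R : nat) (K : finType).
Variables (phi : fo U B 2) (col : A -> K) (G : sgraph) (emb : G -> A).
Hypothesis gA : guarded k pi back root iota.
Hypothesis R_gt0 : 0 < R.
Hypothesis loc : forall x x' : 2.-tuple A,
  similar k iota back R col x x' -> sat phi x = sat phi x'.
Hypothesis adjE : forall u v : G, u != v ->
  adj u v = sat phi [tuple emb u; emb v] || sat phi [tuple emb v; emb u].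

Local Notation ptype := (ptype k R K).
Local Notation W t := (anc back R (iota (emb t))).
Local Notation tp t w := (ptype_of k iota back R col (emb t) w).

Definition lacon_hidden : finType := (V * {set ptype})%type.

Definition lacon_rel (t : G) (h : lacon_hidden) : bool :=
  (h.1 \in W t) && (tp t h.1 \in h.2).

(** A coincidence between ancestors of the two targets happens at an ancestor of [w], so it can be
    read off their types relative to [w]. *)
Lemma pair_similar t t' s s' w :
  (forall u, u \in W t -> u \in W t' -> u \in anc back R w) ->
  (forall u, u \in W s -> u \in W s' -> u \in anc back R w) ->
  tp t w = tp s w -> tp t' w = tp s' w ->
  sat phi [tuple emb t; emb t'] = sat phi [tuple emb s; emb s'].
Proof.
have [_ ch le_k _ _] := gA.
move=> max_t max_s [col_t own_t rel_t] [col_t' own_t' rel_t']; apply: loc.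
have cross (a b : seq 'I_k) : size a <= R -> size b <= R ->
    (ev back a (iota (emb t)) == ev back b (iota (emb t'))) =
    (ev back a (iota (emb s)) == ev back b (iota (emb s'))).
  move=> le_a le_b; apply/eqP/eqP => eq_u.
    have [||c le_c eq_c] := anc_ev le_k (max_t (ev back a (iota (emb t))) _ _).
    - exact: (ev_anc ch).
    - by rewrite eq_u; apply: (ev_anc ch).
    transitivity (ev back c w).
      by apply/eqP; rewrite -(coincidencesP rel_t) // eq_c.
    by apply/esym/eqP; rewrite -(coincidencesP rel_t') // eq_c eq_u.
  have [||c le_c eq_c] := anc_ev le_k (max_s (ev back a (iota (emb s))) _ _).
  - exact: (ev_anc ch).
  - by rewrite eq_u; apply: (ev_anc ch).
  transitivity (ev back c w).
    by apply/eqP; rewrite (coincidencesP rel_t) // eq_c.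
  by apply/esym/eqP; rewrite (coincidencesP rel_t') // eq_c eq_u.
have tnth01 (x y : A) :
    tnth [tuple x; y] ord0 = x /\ tnth [tuple x; y] (lift ord0 ord0) = y.
  by [].
split=> [i|i j a b le_a le_b].
  case: (unliftP ord0 i) => [i' ->|->]; rewrite ?[i']ord1.
    by rewrite !(tnth01 _ _).2.
  by rewrite !(tnth01 _ _).1.
case: (unliftP ord0 i) => [i' ->|->]; case: (unliftP ord0 j) => [j' ->|->];
  rewrite ?[i']ord1 ?[j']ord1 ?(tnth01 _ _).2 ?(tnth01 _ _).1.
- exact: coincidencesP own_t' _ _.
- by rewrite eq_sym cross // eq_sym.
- exact: cross.
exact: coincidencesP own_t _ _.
Qed.

(* What the dominance of [(w, D)] says about a pair: [w] is its largest common
   ancestor, and [D] is exactly the set of its two types relative to [w]. *)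
Definition meets_at (t t' : G) (h : lacon_hidden) : bool :=
  [&& t != t', [forall u in W t :&: W t', u \in anc back R h.1]
    & [set tp t h.1; tp t' h.1] == h.2].

Definition lacon_label (h : lacon_hidden) : bool :=
  [exists t, exists t', meets_at t t' h && adj t t'].

(** By [pair_similar], all pairs meeting at [h] agree. The types form an unordered set and may be
    matched crosswise, which the symmetric disjunction in [adjE] absorbs. *)
Lemma meets_at_adj t t' h : meets_at t t' h -> adj t t' = lacon_label h.
Proof.
move=> tt'h; apply/idP/existsP => [tt'|[s /existsP[s' /andP[ss'h ss']]]].
  by exists t; apply/existsP; exists t'; rewrite tt'h.
case/and3P: tt'h => ne_t /forall_inP max_t /eqP eq_t.
case/and3P: ss'h => ne_s /forall_inP max_s; rewrite -eq_t => /eqP eq_ts.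
have {}max_t u : u \in W t -> u \in W t' -> u \in anc back R h.1.
  by move=> ut ut'; apply: max_t; rewrite inE ut.
have {}max_s u : u \in W s -> u \in W s' -> u \in anc back R h.1.
  by move=> us us'; apply: max_s; rewrite inE us.
have max_t' u ut ut' := max_t u ut' ut; have max_s' u us us' := max_s u us' us.
move: ss'; rewrite !adjE //.
case: (eq_set2 eq_ts) => -[eq1 eq2].
  by rewrite (pair_similar max_s max_t eq1 eq2) (pair_similar max_s' max_t' eq2 eq1).
rewrite (pair_similar max_s max_t' eq1 eq2) (pair_similar max_s' max_t eq2 eq1).
by rewrite orbC.
Qed.

(** The hidden key is lexicographic: first [pi], so that the dominant vertex sits at the largest
    common ancestor; then smaller sets of types get larger keys, so that the set shrinks to the two
    types of the pair. *)
Let key (x : bip_graph lacon_rel) : nat :=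
  let hidden_key (h : lacon_hidden) := pi h.1 * #|ptype|.+1 + (#|ptype| - #|h.2|) in
  match x with
  | inl _ => (\max_(h : lacon_hidden) hidden_key h).+1
  | inr h => hidden_key h
  end.

Lemma key_le (h h' : lacon_hidden) : key (inr h) <= key (inr h') -> pi h.1 <= pi h'.1.
Proof.
move=> /= le_hh'; rewrite -ltnS -(ltn_pmul2r (ltn0Sn #|ptype|)).
apply: leq_ltn_trans (leq_trans (leq_addr _ _) le_hh') _.
by rewrite mulSnr ltn_add2l ltnS leq_subr.
Qed.

(** The dominant vertex is compared with two kinds of competitors: [(u, setT)] for each common
    ancestor [u], and [w] with just the two types. *)
Lemma lacon_dominant t t' h : t != t' ->
  dominant (B := lacon_rel) (linearize key) t t' h -> meets_at t t' h.
Proof.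
have [_ ch le_k _ _] := gA.
case: h => w D ne_tt' []; rewrite !inE => /andP[/andP[tw tD] /andP[t'w t'D]] /= max_h.
rewrite /meets_at ne_tt' /=; apply/andP; split.
  apply/forall_inP => u /setIP[tu t'u]; apply: (anc_anc ch tu tw).
  apply: (@key_le (u, setT) (w, D)).
  by apply/linearize_le/max_h; rewrite !inE /= /lacon_rel /= tu t'u !inE.
rewrite eqEcard; apply/andP; split.
  by apply/subsetP=> x /set2P[]->.
have := max_h (inr (w, [set tp t w; tp t' w])).
rewrite !inE /= /lacon_rel /= tw t'w !inE !eqxx orbT => /(_ isT)/linearize_le.
have card_le (E : {set ptype}) : #|E| <= #|ptype| by apply: max_card.
by rewrite /= leq_add2l leq_sub2lE.
Qed.

Lemma lacon_lacon : lacon_decomposition lacon_label (linearize key).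
Proof.
have [_ ch _ rootP _] := gA.
split=> [|h t|t t'|t t' h ne_tt' dom]; first exact: linearize_inj.
- by apply/linearize_lt; rewrite /= ltnS; apply: (leq_bigmax h).
- have root_W s : root \in W s by apply: (back_sub_anc ch).
  apply/set0Pn; exists (inr (root, setT)).
  by rewrite !inE /= /lacon_rel /= !root_W !inE.
by apply/meets_at_adj/lacon_dominant.
Qed.

Let lacon_back (x : bip_graph lacon_rel) : {set bip_graph lacon_rel} :=
  match x with
  | inl t => x |: inr @: [set h | lacon_rel t h]
  | inr h => inr @: [set h' : lacon_hidden |
      (linearize key (inr h') <= linearize key x) && (h'.1 \in anc back R h.1)]
  end.

Definition lacon_bound : nat := (k ^ R * #|{set ptype}|).+1.

Lemma lacon_back_chordal : chordal_order (linearize key) lacon_back.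
Proof.
have [_ ch _ _ _] := gA.
have inj_inr : injective (inr : lacon_hidden -> bip_graph lacon_rel) by move=> ? ? [].
split=> [|[t|h]|[t|h] [t'|h']|x y z]; first exact: linearize_inj.
- by rewrite setU11.
- by rewrite mem_imset // inE leqnn (anc_refl ch).
- by case/setU1P=> [[->] //|/imsetP[? _] //].
- by case/imsetP.
- by move=> _; apply/ltnW/linearize_lt; rewrite /= ltnS; apply: (leq_bigmax h).
- by case/imsetP=> g; rewrite inE => /andP[le_g _] ->.
have nested (h1 h2 : lacon_hidden) v : h1.1 \in anc back R v -> h2.1 \in anc back R v ->
    linearize key (inr h1) <= linearize key (inr h2) -> inr h1 \in lacon_back (inr h2).
  move=> vh1 vh2 le_h; rewrite mem_imset // inE le_h.
  by apply: (anc_anc ch vh1 vh2); apply/key_le/linearize_le.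
case: y => [t|h].
  case/setU1P=> [->|/imsetP[h1 th1 ->]] /setU1P[->|/imsetP[h2 th2 ->]] le_h.
  - by rewrite setU11.
  - have := linearize_le le_h; rewrite leqNgt /= ltnS.
    by rewrite (leq_bigmax h2).
  - by rewrite !inE mem_imset // orbT.
  rewrite !inE in th1 th2; case/andP: th1 => th1 _; case/andP: th2 => th2 _.
  exact: nested th1 th2 le_h.
case/imsetP=> h1 /[!inE] /andP[_ vh1] -> /imsetP[h2 /[!inE] /andP[_ vh2] ->].
exact: nested vh1 vh2.
Qed.

Lemma lacon_col_inf : col_inf (linearize key) <= lacon_bound.
Proof.
have [_ ch le_k _ _] := gA.
have inj_inr : injective (inr : lacon_hidden -> bip_graph lacon_rel) by move=> ? ? [].
have cov : covers_edges lacon_back.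
  by move=> [t|h] [t'|h'] //= th; [right|left]; rewrite !inE mem_imset ?inE.
apply/bigmax_leqP => v _; apply: (@leq_trans #|lacon_back v|).
  apply/subset_leq_card/subsetP=> u; rewrite inE.
  exact: inf_reachable_back lacon_back_chordal cov _ _.
have card_sub v' (S : {set lacon_hidden}) :
    (forall h, h \in S -> h.1 \in anc back R v') ->
    #|S| <= k ^ R * #|{set ptype}|.
  move=> sub; apply: (@leq_trans #|setX (anc back R v') [set: {set ptype}]|).
    by apply/subset_leq_card/subsetP=> h /sub hv; rewrite !inE hv.
  by rewrite cardsX cardsT leq_mul2r (card_anc _ _ le_k) orbT.
case: v => [t|h] /=.
  apply: leq_trans (leq_card_setU _ _) _; rewrite cards1 card_imset // ltnS.
  by apply: (card_sub (iota (emb t))) => h; rewrite inE => /andP[].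
rewrite card_imset //; apply/leqW/(card_sub h.1) => h'.
by rewrite inE => /andP[].
Qed.
End LaconConstruction.

(** * Chordal orders on copied structures *)

Lemma blow_up_chordal (V : finType) (pi : V -> nat) back m :
  chordal_order pi back ->
  chordal_order (linearize (fun x : V * 'I_m => pi x.1))
    (fun x => [set y : V * 'I_m | (y.1 \in back x.1) &&
       (linearize (fun x : V * 'I_m => pi x.1) y <=
        linearize (fun x : V * 'I_m => pi x.1) x)]).
Proof.
move=> [inj refl le_back tri]; split=> [|x|y x|y x z]; rewrite ?inE.
- exact: linearize_inj.
- by rewrite refl leqnn.
- by case/andP.
move=> /andP[yx _] /andP[zx _] le_yz; rewrite le_yz andbT.
exact: (tri _ _ _ yx zx (linearize_le le_yz)).
Qed.

Lemma add_root_chordal (V : finType) (pi : V -> nat) back :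
  chordal_order pi back ->
  chordal_order (oapp (fun v => (pi v).+1) 0)
    (oapp (fun v => None |: Some @: back v) [set None]).
Proof.
move=> [inj refl le_back tri].
have SomeI : injective (@Some V) by move=> ? ? [].
split=> [[u|] [v|] //= [/inj-> //]|[v|]|u [v|]|u [v|] w] /=.
- by rewrite !inE mem_imset // refl.
- by rewrite inE.
- by case/setU1P=> [->|/imsetP[x /le_back le_x ->]].
- by move/set1P->.
- case/setU1P=> [->|/imsetP[x vx ->]] /setU1P[->|/imsetP[y vy ->]] //=; rewrite ?inE //.
  by move=> le_xy; rewrite mem_imset //; apply: (tri _ _ _ vx vy).
by move=> /set1P-> /set1P->; rewrite inE.
Qed.

(** Each of at most [k.+1] members of a [back0] set has [m] copies, and the root is added. *)
Lemma copy_guarded (p m k : nat) (G : sgraph) (P : 'I_p -> pred G) :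
  treewidth_at_most k G ->
  exists (pi : option (G * 'I_m) -> nat) back,
    guarded (S := copy m (expansion P)) (k.+1 * m).+1 pi back None Some.
Proof.
move=> /treewidth_chordal[pi0 [back0 [ch0 cov0 le_k]]].
have ch1 := blow_up_chordal m ch0; have [inj0 refl0 le_back0 _] := ch0.
do 2!eexists; split; [by move=> ? ? [] | exact: add_root_chordal ch1 | | |].
- case=> [[v i]|] /=; last by rewrite cards1.
  apply: leq_trans (leq_card_setU _ _) _; rewrite cards1 add1n ltnS.
  rewrite card_imset => [|? ? [] //]; apply: (@leq_trans #|setX (back0 v) [set: 'I_m]|).
    by apply/subset_leq_card/subsetP=> x; rewrite !inE => /andP[->].
  by rewrite cardsX cardsT card_ord leq_mul2r le_k orbT.
- by case=> [v|]; rewrite /= ?setU11 ?set11.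
move=> b x y xy; have {xy} : x.1 \in back0 y.1 \/ y.1 \in back0 x.1.
  by case: b xy => [R /andP[_ /cov0] //|/eqP->]; left.
set pi1 := linearize _.
wlog le_xy : x y / pi1 x <= pi1 y.
  move=> IH xy; have [le_xy|/ltnW le_yx] := leqP (pi1 x) (pi1 y); first exact: IH.
  by apply/or_comm/IH => //; apply/or_comm.
move=> xy; left; apply/setU1P; right; rewrite mem_imset => [|? ? [] //].
(* In the second case both orders force [x] and [y] to be copies of the same vertex. *)
rewrite inE le_xy andbT; case: xy => // /le_back0 le_yx.
rewrite (inj0 x.1 y.1) //; apply/anti_leq; rewrite le_yx.
by have := linearize_le le_xy => ->.
Qed.

Lemma transduction_lacon (C : graph_class) : structurally_bounded_treewidth C ->
  exists t : nat, forall G : sgraph, C G ->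
    exists (H : finType) (B : G -> H -> bool) (label : H -> bool)
           (pi : bip_graph B -> nat),
      lacon_decomposition label pi /\ col_inf pi < t.
Proof.
case=> C' [[p m tau0] [[k le_k] sub]].
pose k' := (k.+1 * m).+1; have [R [K loc]] := fo_local k' (phi tau0).
exists (lacon_bound k' R.+1 K).+1 => G.
case/sub=> G' [P /= [/le_k tw _ [f /bij_inj inj_f fE]]].
have [pi [back gA]] := copy_guarded m P tw.
pose A := copy m (expansion P); have [col loc_col] := loc A _ _ _ _ _ gA.
have loc' (x x' : 2.-tuple A) : similar k' Some back R.+1 col x x' ->
    sat (phi tau0) x = sat (phi tau0) x'.
  by move=> sim; apply: loc_col; apply: similar_weaken sim.
pose emb (v : G) : A := val (f v).
have adjE u v : u != v -> adj u v =
    sat (phi tau0) [tuple emb u; emb v] || sat (phi tau0) [tuple emb v; emb u].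
  by move=> ne_uv; rewrite -fE /= /basic_adj (inj_eq inj_f) ne_uv.
do 4!eexists; split; first exact: lacon_lacon gA (ltn0Sn R) loc' adjE.
exact: lacon_col_inf gA.
Qed.

Theorem theorem8 (C : graph_class) :
  [<-> structurally_bounded_treewidth C;

       exists t : nat, forall G : sgraph, C G ->
         exists (H : finType) (B : G -> H -> bool) (label : H -> bool)
                (pi : bip_graph B -> nat),
           lacon_decomposition label pi /\ col_inf pi < t;

       exists (t : nat) (S : {pred 'I_1 * 'I_1 * nat}),
         forall G : sgraph, C G ->
         exists (F : sgraph) (d : nat),
           [/\ d <= t, shrub_decomposition d G F S & treewidth_at_most t F];

       exists (d : nat) (C' : graph_class),
         bounded_treewidth C' /\
         forall G : sgraph, C G ->
         exists (H : finType) (B : G -> H -> bool),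
           parity_decomposition d B /\ C' (bip_graph B)].
Proof.
tfae.
- exact: transduction_lacon.
- case=> t lacon; exists (shrub_diameter t), (shrub_signature t) => G /lacon.
  case=> [H [B [label [pi [lac /ltnW/(lacon_hidden_order lac)[back ho]]]]]].
  exists (shrub_graph B label (fun h => pi (inr h)) t), (shrub_diameter t).
  by split=> //; [apply: shrub_shrub ho | apply: shrub_treewidth ho].
(* The route from (3) to (4) passes through (1) and (2): a transduction recovers the graphs from
   their shrub-decompositions, which yields lacon-decompositions and then parity-decompositions. *)
- case=> t [S shrub].
  have /transduction_lacon[c lacon] : structurally_bounded_treewidth C.
    exists (treewidth_at_most t); eexists; split=> [|G /shrub[F [d [le_dt dec tw]]]].
      by exists t.
    exact: shrub_transduction le_dt dec tw.
  exists (2 ^ c), (treewidth_at_most (2 ^ c)); split; first by exists (2 ^ c).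
  move=> G /lacon[H [B [label [pi [lac /ltnW/(lacon_hidden_order lac)[back ho]]]]]].
  exists {set H}, (parity_rel B label (fun h => pi (inr h))).
  by split; [apply: parity_parity ho | apply: parity_treewidth ho].
case=> d [C' [tw parity]].
exists C'; eexists; split=> // G /parity[H [B [dec C'B]]].
exact: parity_transduction dec C'B.
Qed.
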